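(* Let $K$ be a field and let $\iota_k: B_k\to A_k$ be homomorphisms of finite dimensional $K$-algebras for $k=1,\dots,n$, where each $B_k$ is a separable $K$-algebra. Let $B=B_1\otimes_K\cdots\otimes_K B_n$, $A=A_1\otimes_K\cdots\otimes_K A_n$, and let $B\to A$ be the homomorphism induced by $\iota=\iota_1\otimes\cdots\otimes\iota_n$. Then $A\mid B$ is D2 if and only if $A_k\mid B_k$ is D2 for each $k=1,\dots,n$.
   Context: Algebras are unital and associative, not necessarily commutative. An algebra extension $A\mid B$ is a unit-preserving algebra homomorphism $B\to A$. $X\oplus *\cong Y$ means $X$ is isomorphic to a direct summand of $Y$. $A\mid B$ is left D2 (respectively right D2) if $A\otimes_BA\oplus *\cong A^N$ for some positive integer $N$ as $B$-$A$-bimodules (respectively $A$-$B$-bimodules); it is D2 (depth two) if it is both left and right D2. A $K$-algebra $B$ is separable if $B$ is projective as a module over $B\otimes_K B^{\mathrm{op}}$. *)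

(* Defs.v *)
From HB Require Import structures.
From mathcomp Require Import all_boot all_algebra falgebra boolp.

Set Implicit Arguments.
Unset Strict Implicit.
Unset Printing Implicit Defensive.

Import GRing.Theory.
Local Open Scope ring_scope.
Local Open Scope quotient_scope.

(* Balanced tensor products.  For K-spaces M and N and a set S of operators   *)
(* acting on the right of M by rho and on the left of N by lam, the tensor    *)
(* product is the quotient of the finite formal sums of pairs (m, n), encoded *)
(* as sequences, by the least congruence making the class of (m, n) bilinear  *)
(* in m and n and S-balanced; see tensor_universal.                           *)
Section Tensor.
Variables (K : fieldType) (M N : lmodType K) (S : Type).
Variables (rho : M -> S -> M) (lam : S -> N -> N).

Definition scale_sum (k : K) (s : seq (M * N)) :=
  [seq (k *: p.1, p.2) | p <- s].

Inductive tens_eqv : seq (M * N) -> seq (M * N) -> Prop :=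
| tens_refl s : tens_eqv s s
| tens_sym s t : tens_eqv s t -> tens_eqv t s
| tens_trans s t u : tens_eqv s t -> tens_eqv t u -> tens_eqv s u
| tens_cat s s' t t' :
    tens_eqv s s' -> tens_eqv t t' -> tens_eqv (s ++ t) (s' ++ t')
| tens_catC s t : tens_eqv (s ++ t) (t ++ s)
| tens_scale k s t : tens_eqv s t -> tens_eqv (scale_sum k s) (scale_sum k t)
| tens_0l n : tens_eqv [:: (0, n)] [::]
| tens_Dl m m' n : tens_eqv [:: (m + m', n)] [:: (m, n); (m', n)]
| tens_Dr m n n' : tens_eqv [:: (m, n + n')] [:: (m, n); (m, n')]
| tens_Z k m n : tens_eqv [:: (k *: m, n)] [:: (m, k *: n)]
| tens_bal m s n : tens_eqv [:: (rho m s, n)] [:: (m, lam s n)].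

Definition tens_rel (s t : seq (M * N)) := `[< tens_eqv s t >].

Fact tens_rel_refl : reflexive tens_rel.
Proof. by move=> s; apply/asboolP/tens_refl. Qed.
Fact tens_rel_sym : symmetric tens_rel.
Proof. by move=> s t; apply/asboolP/asboolP => /tens_sym. Qed.
Fact tens_rel_trans : transitive tens_rel.
Proof.
move=> t s u /asboolP st /asboolP tu.
by apply/asboolP/(tens_trans st tu).
Qed.
Canonical tens_equiv :=
  EquivRel tens_rel tens_rel_refl tens_rel_sym tens_rel_trans.

Definition tensor := {eq_quot tens_equiv}.
HB.instance Definition _ := Choice.on tensor.
HB.instance Definition _ := EqQuotient.on tensor.

Fact tens_quotW (P : tensor -> Prop) :
  (forall s, P (\pi_tensor s)) -> forall x, P x.
Proof. by move=> Ppi x; rewrite -[x]reprK. Qed.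

Fact tens_piP s t : tens_eqv s t <-> \pi_tensor s = \pi_tensor t.
Proof.
split=> [st|st]; first by apply/eqmodP/asboolP.
by move/eqmodP/asboolP: st.
Qed.

Fact tens_repr s : tens_eqv (repr (\pi_tensor s)) s.
Proof. by apply/tens_piP; rewrite reprK. Qed.

Definition tens_zero : tensor := \pi_tensor [::].
Definition tens_add (x y : tensor) : tensor := \pi_tensor (repr x ++ repr y).
Definition tens_scl k (x : tensor) : tensor :=
  \pi_tensor (scale_sum k (repr x)).
Definition tens_opp (x : tensor) : tensor := tens_scl (-1) x.
Definition tens (m : M) (n : N) : tensor := \pi_tensor [:: (m, n)].

Fact pi_cat s t :
  \pi_tensor (s ++ t) = tens_add (\pi_tensor s) (\pi_tensor t).
Proof.
by apply/tens_piP/tens_sym/tens_cat; apply: tens_repr.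
Qed.

Fact pi_cons p s :
  \pi_tensor (p :: s) = tens_add (\pi_tensor [:: p]) (\pi_tensor s).
Proof. exact: (pi_cat [:: p]). Qed.

Fact pi_scale k s : \pi_tensor (scale_sum k s) = tens_scl k (\pi_tensor s).
Proof. by apply/tens_piP/tens_sym/tens_scale/tens_repr. Qed.

Fact tens_addA : associative tens_add.
Proof.
move=> x y z; elim/tens_quotW: x => s; elim/tens_quotW: y => t; elim/tens_quotW: z => u.
by rewrite -!pi_cat catA.
Qed.
Fact tens_addC : commutative tens_add.
Proof.
move=> x y; elim/tens_quotW: x => s; elim/tens_quotW: y => t; rewrite -!pi_cat.
by apply/tens_piP/tens_catC.
Qed.
Fact tens_add0 : left_id tens_zero tens_add.
Proof. by move=> x; elim/tens_quotW: x => s; rewrite -pi_cat. Qed.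
Fact tens_scl1 x : tens_scl 1 x = x.
Proof.
elim/tens_quotW: x => s; rewrite -pi_scale; congr (\pi _).
by elim: s => //= -[m n] s ->; rewrite scale1r.
Qed.
Fact tens_sclA a b x : tens_scl a (tens_scl b x) = tens_scl (a * b) x.
Proof.
elim/tens_quotW: x => s; rewrite -!pi_scale; congr (\pi _).
by elim: s => //= -[m n] s /= ->; rewrite scalerA.
Qed.
Fact tens_sclDr k x y :
  tens_scl k (tens_add x y) = tens_add (tens_scl k x) (tens_scl k y).
Proof.
elim/tens_quotW: x => s; elim/tens_quotW: y => t.
by rewrite -pi_cat -!pi_scale -pi_cat /scale_sum map_cat.
Qed.
Fact tens_addACA x y z t :
  tens_add (tens_add x y) (tens_add z t) =
  tens_add (tens_add x z) (tens_add y t).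
Proof. by rewrite -!tens_addA (tens_addA y) (tens_addC y) -tens_addA. Qed.
Fact tens_sclDl x a b :
  tens_scl (a + b) x = tens_add (tens_scl a x) (tens_scl b x).
Proof.
elim/tens_quotW: x => s; rewrite -!pi_scale; elim: s => [|[m n] s IH].
  by rewrite -pi_cat.
rewrite (pi_cons _ (scale_sum (a + b) s)) IH.
have -> : \pi_tensor [:: ((a + b) *: m, n)] =
    tens_add (\pi [:: (a *: m, n)]) (\pi [:: (b *: m, n)]).
  by rewrite -pi_cat scalerDl; apply/tens_piP/tens_Dl.
rewrite (pi_cons _ (scale_sum a s)) (pi_cons _ (scale_sum b s)).
exact: tens_addACA.
Qed.
Fact tens_scl0 x : tens_scl 0 x = tens_zero.
Proof.
elim/tens_quotW: x => s; rewrite -pi_scale; elim: s => [//|[m n] s IH].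
rewrite (pi_cons _ (scale_sum 0 s)) IH tens_addC tens_add0 scale0r.
by apply/tens_piP/tens_0l.
Qed.
Fact tens_addN : left_inverse tens_zero tens_opp tens_add.
Proof.
by move=> x; rewrite -{2}(tens_scl1 x) -tens_sclDl addNr tens_scl0.
Qed.

HB.instance Definition _ :=
  GRing.isZmodule.Build tensor tens_addA tens_addC tens_add0 tens_addN.
HB.instance Definition _ :=
  GRing.Zmodule_isLmodule.Build K tensor
    tens_sclA tens_scl1 tens_sclDr tens_sclDl.

Lemma tensDl m m' n : tens (m + m') n = tens m n + tens m' n.
Proof. by rewrite -[RHS]pi_cat; apply/tens_piP/tens_Dl. Qed.
Lemma tensDr m n n' : tens m (n + n') = tens m n + tens m n'.
Proof. by rewrite -[RHS]pi_cat; apply/tens_piP/tens_Dr. Qed.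
Lemma tensZl k m n : tens (k *: m) n = k *: tens m n.
Proof. by rewrite -[RHS]pi_scale. Qed.
Lemma tensZr k m n : tens m (k *: n) = k *: tens m n.
Proof. by rewrite -tensZl; apply/tens_piP/tens_sym/tens_Z. Qed.
Lemma tens_balE m s n : tens (rho m s) n = tens m (lam s n).
Proof. exact/tens_piP/tens_bal. Qed.

Lemma tensor_ind (P : tensor -> Prop) :
  P 0 -> (forall m n x, P x -> P (tens m n + x)) -> forall x, P x.
Proof.
move=> P0 PD x; elim/tens_quotW: x; elim=> [//|[m n] s IH].
by rewrite pi_cons; apply: PD.
Qed.

Definition bilinear_map (W : lmodType K) (f : M -> N -> W) : Prop :=
  (forall k m m' n, f (k *: m + m') n = k *: f m n + f m' n) /\
  (forall k m n n', f m (k *: n + n') = k *: f m n + f m n').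

Definition balanced (W : lmodType K) (f : M -> N -> W) : Prop :=
  bilinear_map f /\ (forall m s n, f (rho m s) n = f m (lam s n)).

Definition tens_lift (W : lmodType K) (f : M -> N -> W) (x : tensor) : W :=
  \sum_(p <- repr x) f p.1 p.2.

Lemma bilinear_tens : bilinear_map tens.
Proof. by split=> *; rewrite ?tensDl ?tensDr ?tensZl ?tensZr. Qed.

Lemma balanced_tens : balanced tens.
Proof. by split; [exact: bilinear_tens | exact: tens_balE]. Qed.

Section Lift.
Variables (W : lmodType K) (f : M -> N -> W) (bal_f : balanced f).

Fact bal0l n : f 0 n = 0.
Proof.
have [[fl _] _] := bal_f; have := fl (-1) 0 0 n.
by rewrite !scaleN1r oppr0 addr0 addNr.
Qed.
Fact balDl m m' n : f (m + m') n = f m n + f m' n.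
Proof. by have [[fl _] _] := bal_f; have := fl 1 m m' n; rewrite !scale1r. Qed.
Fact balZl k m n : f (k *: m) n = k *: f m n.
Proof.
by have [[fl _] _] := bal_f; have := fl k m 0 n; rewrite bal0l !addr0.
Qed.
Fact bal0r m : f m 0 = 0.
Proof.
have [[_ fr] _] := bal_f; have := fr (-1) m 0 0.
by rewrite !scaleN1r oppr0 addr0 addNr.
Qed.
Fact balDr m n n' : f m (n + n') = f m n + f m n'.
Proof. by have [[_ fr] _] := bal_f; have := fr 1 m n n'; rewrite !scale1r. Qed.
Fact balZr k m n : f m (k *: n) = k *: f m n.
Proof.
by have [[_ fr] _] := bal_f; have := fr k m n 0; rewrite bal0r !addr0.
Qed.

Fact tens_lift_eqv s t : tens_eqv s t ->
  \sum_(p <- s) f p.1 p.2 = \sum_(p <- t) f p.1 p.2.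
Proof.
elim=> {s t} //.
- by move=> s t u _ -> _ ->.
- by move=> s s' t t' _ Es _ Et; rewrite !big_cat /= Es Et.
- by move=> s t; rewrite !big_cat /= addrC.
- move=> k s t _ E; rewrite !big_map /=.
  under eq_bigr do rewrite balZl.
  rewrite -scaler_sumr E scaler_sumr.
  by under [RHS]eq_bigr do rewrite balZl.
- by move=> n; rewrite big_seq1 big_nil bal0l.
- by move=> m m' n; rewrite big_seq1 big_cons big_seq1 /= balDl.
- by move=> m n n'; rewrite big_seq1 big_cons big_seq1 /= balDr.
- by move=> k m n; rewrite !big_seq1 /= balZl balZr.
- by move=> m s n; rewrite !big_seq1 /=; case: bal_f.
Qed.

Lemma tens_liftE m n : tens_lift f (tens m n) = f m n.
Proof. by rewrite /tens_lift (tens_lift_eqv (tens_repr _)) big_seq1. Qed.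

Lemma tens_lift_linear : linear (tens_lift f).
Proof.
move=> k x y; elim/tens_quotW: x => s; elim/tens_quotW: y => t.
rewrite -[k *: _]pi_scale -[_ + _]pi_cat /tens_lift.
rewrite !(tens_lift_eqv (tens_repr _)) big_cat big_map scaler_sumr /=.
by congr (_ + _); apply: eq_bigr => p _; rewrite balZl.
Qed.
End Lift.

Lemma tensor_universal (W : lmodType K) (f : M -> N -> W) : balanced f ->
  exists2 g : {linear tensor -> W}, (forall m n, g (tens m n) = f m n) &
    forall h : {linear tensor -> W}, (forall m n, h (tens m n) = f m n) ->
      h =1 g.
Proof.
move=> bal_f.
pose gL := GRing.isLinear.Build _ _ _ _ _ (tens_lift_linear bal_f).
pose g : {linear tensor -> W} := HB.pack (tens_lift f) gL.
exists g => [m n|h hE x]; first exact: tens_liftE.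
elim/tensor_ind: x => [|m n x IH]; first by rewrite !linear0.
by rewrite !linearD IH hE; congr (_ + _); rewrite -(tens_liftE bal_f).
Qed.
End Tensor.

(* M ⊗_K N is the case S = K. *)
Section TensorK.
Variables (K : fieldType).

Fact linear_at0 (M N : lmodType K) (f : M -> N) : linear f -> f 0 = 0.
Proof.
by move=> lf; have := lf (-1) 0 0; rewrite !scaleN1r oppr0 addr0 addNr.
Qed.

Fact linear_comb (M N : lmodType K) (f g : M -> N) k :
  linear f -> linear g -> linear (fun x => k *: f x + g x).
Proof.
move=> lf lg l x y; rewrite lf lg !scalerDr !scalerA (mulrC k).
by rewrite addrACA.
Qed.

Definition tensorK (M N : lmodType K) : Type :=
  tensor (fun (m : M) (k : K) => k *: m) (fun k (n : N) => k *: n).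
HB.instance Definition _ M N := GRing.Lmodule.on (tensorK M N).

Definition tensK (M N : lmodType K) (m : M) (n : N) : tensorK M N :=
  tens _ _ m n.

Lemma bilinear_tensK (M N : lmodType K) : bilinear_map (@tensK M N).
Proof. exact: bilinear_tens. Qed.

Lemma bilinear_balanced (M N W : lmodType K) (f : M -> N -> W) :
  bilinear_map f ->
  balanced (fun (m : M) (k : K) => k *: m) (fun k (n : N) => k *: n) f.
Proof.
move=> [fl fr]; split=> // m k n.
have f0l : f 0 n = 0 by apply: (@linear_at0 _ _ (f^~ n)) => ? ? ?; apply: fl.
have f0r : f m 0 = 0 by apply: linear_at0 => ? ? ?; apply: fr.
have := fl k m 0 n; have := fr k m n 0.
by rewrite f0l f0r !addr0 => -> ->.
Qed.

Definition liftK (M N W : lmodType K) (f : M -> N -> W) : tensorK M N -> W :=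
  tens_lift f.

Lemma liftKE (M N W : lmodType K) (f : M -> N -> W) m n :
  bilinear_map f -> liftK f (tensK m n) = f m n.
Proof. by move/bilinear_balanced/tens_liftE; apply. Qed.

Lemma liftK_linear (M N W : lmodType K) (f : M -> N -> W) :
  bilinear_map f -> linear (liftK f).
Proof. by move/bilinear_balanced/tens_lift_linear. Qed.

Lemma tensK_ind (M N : lmodType K) (P : tensorK M N -> Prop) :
  P 0 -> (forall m n x, P x -> P (tensK m n + x)) -> forall x, P x.
Proof. exact: tensor_ind. Qed.

Lemma tensK_ext (M N W : lmodType K) (f g : tensorK M N -> W) :
  linear f -> linear g ->
  (forall m n, f (tensK m n) = g (tensK m n)) -> f =1 g.
Proof.
move=> lf lg fg.
elim/tensK_ind=> [|m n x IH]; first by rewrite !linear_at0.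
by rewrite -[tensK m n]scale1r lf lg IH fg.
Qed.

Section FinDim.
Variables (M N : vectType K).
Import VectorInternalTheory.

Let coords (m : M) (n : N) : 'M[K]_(dim M, dim N) := (v2r m)^T *m v2r n.

Let coords_bilinear : bilinear_map coords.
Proof.
split=> [k m m' n|k m n n']; rewrite /coords linearP /=.
  by rewrite linearP /= mulmxDl -scalemxAl.
by rewrite mulmxDr -scalemxAr.
Qed.

Let to_mx : tensorK M N -> 'M[K]_(dim M, dim N) := liftK coords.
Let of_mx (A : 'M[K]_(dim M, dim N)) : tensorK M N :=
  \sum_i \sum_j A i j *: tensK (r2v (delta_mx 0 i)) (r2v (delta_mx 0 j)).

Let to_mxP : linear to_mx.
Proof. exact: liftK_linear. Qed.

Let of_mxP : linear of_mx.
Proof.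
move=> k A B; rewrite /of_mx scaler_sumr -big_split /=.
apply: eq_bigr => i _; rewrite scaler_sumr -big_split /=.
by apply: eq_bigr => j _; rewrite !mxE scalerDl scalerA.
Qed.

Let tensK_suml (I : finType) (c : I -> K) (v : I -> M) (n : N) :
  tensK (\sum_i c i *: v i) n = \sum_i c i *: tensK (v i) n.
Proof.
elim/big_rec2: _ => [|i x y _ <-]; last first.
  by rewrite (bilinear_tensK M N).1.
apply: (@linear_at0 _ _ (fun m => tensK m n)) => ? ? ?.
exact: (bilinear_tensK M N).1.
Qed.

Let tensK_sumr (I : finType) (c : I -> K) (m : M) (v : I -> N) :
  tensK m (\sum_i c i *: v i) = \sum_i c i *: tensK m (v i).
Proof.
elim/big_rec2: _ => [|i x y _ <-]; last first.
  by rewrite (bilinear_tensK M N).2.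
apply: (@linear_at0 _ _ (@tensK M N m)) => ? ? ?.
exact: (bilinear_tensK M N).2.
Qed.

Let coordE (V : vectType K) (v : V) :
  v = \sum_i v2r v 0 i *: r2v (delta_mx 0 i).
Proof.
apply: v2r_inj; rewrite linear_sum /= [LHS]row_sum_delta.
by apply: eq_bigr => i _; rewrite linearZ /= r2vK.
Qed.

Let to_mxK : cancel to_mx of_mx.
Proof.
apply: tensK_ext => [k x y|//|m n]; first by rewrite to_mxP of_mxP.
rewrite /to_mx liftKE // /of_mx [in RHS](coordE m) tensK_suml.
apply: eq_bigr => i _; rewrite [in RHS](coordE n) tensK_sumr scaler_sumr.
by apply: eq_bigr => j _; rewrite /coords !mxE big_ord1 !mxE scalerA.
Qed.

Let of_mxK : cancel of_mx to_mx.
Proof.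
move=> A.
pose f : {linear _ -> _} := HB.pack to_mx
  (GRing.isLinear.Build _ _ _ _ _ to_mxP).
rewrite [RHS]matrix_sum_delta -[LHS]/(f _) linear_sum; apply: eq_bigr => i _.
rewrite linear_sum; apply: eq_bigr => j _.
rewrite linearZ /= /to_mx liftKE // /coords !r2vK trmx_delta.
by rewrite mul_delta_mx.
Qed.

Fact tensorK_vect : Vector.axiom (dim M * dim N) (tensorK M N).
Proof.
exists (fun x => mxvec (to_mx x)) => [k x y|].
  by rewrite to_mxP linearP.
exists (fun v => of_mx (vec_mx v)) => [x|v].
  by rewrite mxvecK to_mxK.
by rewrite of_mxK vec_mxK.
Qed.
HB.instance Definition _ := Lmodule_hasFinDim.Build K (tensorK M N) tensorK_vect.

Lemma tensK_neq0 (m : M) (n : N) : m != 0 -> n != 0 -> tensK m n != 0.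
Proof.
move=> m0 n0; apply/negP => /eqP /(congr1 to_mx).
rewrite (linear_at0 to_mxP) /to_mx liftKE // => /matrixP coords0.
have [i mi] : exists i, v2r m 0 i != 0.
  apply/existsP; rewrite -negb_forall; apply: contra m0 => /forallP m0.
  apply/eqP/v2r_inj; rewrite linear0; apply/rowP => i.
  by rewrite mxE; apply/eqP.
have [j nj] : exists j, v2r n 0 j != 0.
  apply/existsP; rewrite -negb_forall; apply: contra n0 => /forallP n0.
  apply/eqP/v2r_inj; rewrite linear0; apply/rowP => j.
  by rewrite mxE; apply/eqP.
have := coords0 i j; rewrite /coords !mxE big_ord1 !mxE => /eqP.
by rewrite mulf_eq0 (negPf mi) (negPf nj).
Qed.
End FinDim.
End TensorK.

(* (a ⊗ b) * (c ⊗ d) = (a * c) ⊗ (b * d), see tensKM. *)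
Section TensorAlg.
Variables (K : fieldType) (A B : falgType K).
Local Notation T := (tensorK A B).

Definition tens_one : T := tensK 1 1.
Definition tens_mul (x y : T) : T :=
  liftK (fun a b => liftK (fun c d => tensK (a * c) (b * d)) y) x.

Let mul_inner a b : bilinear_map (fun c d => tensK (a * c) (b * d) : T).
Proof.
split=> [k c c' d|k c d d']; rewrite mulrDr -scalerAr.
  exact: (bilinear_tensK A B).1.
exact: (bilinear_tensK A B).2.
Qed.

Let mul_outer y :
  bilinear_map (fun a b => liftK (fun c d => tensK (a * c) (b * d) : T) y).
Proof.
split=> [k a a' b|k a b b'].
  move: y; apply: tensK_ext => [||c d].
  - exact: liftK_linear.
  - by apply: linear_comb; apply: liftK_linear.
  by rewrite !liftKE // mulrDl -scalerAl (bilinear_tensK A B).1.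
move: y; apply: tensK_ext => [||c d].
- exact: liftK_linear.
- by apply: linear_comb; apply: liftK_linear.
by rewrite !liftKE // mulrDl -scalerAl (bilinear_tensK A B).2.
Qed.

Fact tens_mulE a b c d :
  tens_mul (tensK a b) (tensK c d) = tensK (a * c) (b * d).
Proof. by rewrite /tens_mul !liftKE. Qed.

Let mulPl y : linear (tens_mul^~ y).
Proof. exact: liftK_linear. Qed.

Let mulPr x : linear (tens_mul x).
Proof.
move=> k y z; move: x; apply: tensK_ext => [||a b].
- exact: mulPl.
- by apply: linear_comb; apply: mulPl.
by rewrite /tens_mul !liftKE // liftK_linear.
Qed.

Fact tens_mulA : associative tens_mul.
Proof.
move=> x y z; move: x; apply: tensK_ext => [||a b].
- exact: mulPl.
- by move=> k x x'; rewrite !mulPl.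
move: y; apply: tensK_ext => [||c d].
- by move=> k y y'; rewrite mulPl mulPr.
- by move=> k y y'; rewrite mulPr mulPl.
move: z; apply: tensK_ext => [||e f].
- by move=> k z z'; rewrite !mulPr.
- exact: mulPr.
by rewrite !tens_mulE !mulrA.
Qed.

Fact tens_mul1 : left_id tens_one tens_mul.
Proof.
by apply: tensK_ext => [||a b] //; rewrite ?tens_mulE ?mul1r //; exact: mulPr.
Qed.

Fact tens_1mul : right_id tens_one tens_mul.
Proof.
by apply: tensK_ext => [||a b] //; rewrite ?tens_mulE ?mulr1 //; exact: mulPl.
Qed.

Fact tens_mulDl : left_distributive tens_mul +%R.
Proof. by move=> x y z; have := mulPl z 1 x y; rewrite !scale1r. Qed.

Fact tens_mulDr : right_distributive tens_mul +%R.
Proof. by move=> x y z; have := mulPr x 1 y z; rewrite !scale1r. Qed.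

Fact tens_1neq0 : tens_one != 0.
Proof. by apply: tensK_neq0; exact: oner_neq0. Qed.

HB.instance Definition _ := GRing.Zmodule_isNzRing.Build T
  tens_mulA tens_mul1 tens_1mul tens_mulDl tens_mulDr tens_1neq0.

Fact tens_scalerAl k (x y : T) : k *: (x * y) = (k *: x) * y.
Proof.
have mul0 : tens_mul 0 y = 0 := linear_at0 (mulPl y).
by have := mulPl y k x 0; rewrite mul0 !addr0.
Qed.
HB.instance Definition _ := GRing.Lmodule_isLalgebra.Build K T tens_scalerAl.

Fact tens_scalerAr k (x y : T) : k *: (x * y) = x * (k *: y).
Proof.
have mul0 : tens_mul x 0 = 0 := linear_at0 (mulPr x).
by have := mulPr x k y 0; rewrite mul0 !addr0.
Qed.
HB.instance Definition _ := GRing.Lalgebra_isAlgebra.Build K T tens_scalerAr.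
HB.instance Definition _ := Algebra_isFalgebra.Build K T.

Lemma tensK1 : tensK 1 1 = 1 :> T.
Proof. by []. Qed.

Lemma tensKM a b c d : tensK a b * tensK c d = tensK (a * c) (b * d) :> T.
Proof. exact: tens_mulE. Qed.
End TensorAlg.

Section TensorHom.
Variables (K : fieldType) (A A' B B' : falgType K).
Variables (f : {lrmorphism A -> A'}) (g : {lrmorphism B -> B'}).

Definition tens_hom : tensorK A B -> tensorK A' B' :=
  liftK (fun a b => tensK (f a) (g b)).

Let hom_bilinear : bilinear_map (fun a b => tensK (f a) (g b)).
Proof.
split=> [k a a' b|k a b b']; rewrite linearP.
  exact: (bilinear_tensK A' B').1.
exact: (bilinear_tensK A' B').2.
Qed.

Lemma tens_homE a b : tens_hom (tensK a b) = tensK (f a) (g b).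
Proof. exact: liftKE. Qed.

Fact tens_hom_linear : linear tens_hom.
Proof. exact: liftK_linear. Qed.
HB.instance Definition _ := GRing.isLinear.Build K _ _ _ tens_hom tens_hom_linear.

Fact tens_hom_monoid : monoid_morphism tens_hom.
Proof.
split=> [|x y]; first by rewrite -tensK1 tens_homE !rmorph1.
move: x; apply: tensK_ext => [||a b].
- by move=> k x x'; rewrite mulrDl -scalerAl linearP.
- by move=> k x x'; rewrite linearP /= mulrDl -scalerAl.
move: y; apply: tensK_ext => [||c d].
- by move=> k y y'; rewrite mulrDr -scalerAr linearP.
- by move=> k y y'; rewrite linearP /= mulrDr -scalerAr.
by rewrite tensKM !tens_homE tensKM !rmorphM.
Qed.
HB.instance Definition _ := GRing.isMonoidMorphism.Build _ _ tens_hom tens_hom_monoid.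
End TensorHom.

(* A_0 ⊗ (A_1 ⊗ (... ⊗ A_n)) *)
Fixpoint tens_fam (K : fieldType) (n : nat) :
    ('I_n.+1 -> falgType K) -> falgType K :=
  match n with
  | 0 => fun A => A ord0
  | n'.+1 => fun A => tensorK (A ord0) (tens_fam (fun i => A (lift ord0 i)))
  end.

Fixpoint tens_fam_hom (K : fieldType) (n : nat) :
    forall (A B : 'I_n.+1 -> falgType K),
    (forall k, {lrmorphism B k -> A k}) ->
    {lrmorphism tens_fam B -> tens_fam A} :=
  match n with
  | 0 => fun A B f => f ord0
  | n'.+1 => fun A B f =>
      tens_hom (f ord0) (tens_fam_hom (fun i => f (lift ord0 i)))
  end.

(* R-S-bimodules over K, i.e. K acts in the same way through R and through S. *)
HB.mixin Record Lmodule_isBimodule (K : fieldType) (R S : algType K) M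
    of GRing.Lmodule K M := {
  lact : R -> M -> M;
  ract : M -> S -> M;
  lact1 : forall m, lact 1 m = m;
  lactA : forall r r' m, lact (r * r') m = lact r (lact r' m);
  lactPl : forall m, linear (lact^~ m);
  lactPr : forall r, linear (lact r);
  ract1 : forall m, ract m 1 = m;
  ractA : forall m s s', ract m (s * s') = ract (ract m s) s';
  ractPl : forall s, linear (ract^~ s);
  ractPr : forall m, linear (ract m);
  lract : forall r m s, ract (lact r m) s = lact r (ract m s)
}.
#[short(type="bimodType")]
HB.structure Definition Bimodule (K : fieldType) (R S : algType K) :=
  {M of Lmodule_isBimodule K R S M & GRing.Lmodule K M}.

Section Opposite.
Variables (K : fieldType) (A : falgType K).

HB.instance Definition _ := GRing.Lmodule.copy A^c A.
Let conv_mul (x y : A^c) : A^c := x * y.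
Fact conv_scalerAl k (x y : A^c) : k *: conv_mul x y = conv_mul (k *: x) y.
Proof. exact: (@scalerAr K A k y x). Qed.
HB.instance Definition _ := GRing.Lmodule_isLalgebra.Build K A^c conv_scalerAl.
Fact conv_scalerAr k (x y : A^c) : k *: conv_mul x y = conv_mul x (k *: y).
Proof. exact: (@scalerAl K A k y x). Qed.
HB.instance Definition _ := GRing.Lalgebra_isAlgebra.Build K A^c conv_scalerAr.
HB.instance Definition _ := Vector.copy A^c A.
End Opposite.

Definition projective (R : pzRingType) (P : lmodType R) : Prop :=
  forall (M N : lmodType R) (p : {linear M -> N}) (f : {linear P -> N}),
    (forall y, exists x, p x = y) ->
    exists g : {linear P -> M}, forall x, p (g x) = f x.

(* B as a left module over B ⊗ B^op: (a ⊗ c) *: b = a * b * c, see env_actE. *)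
Section Enveloping.
Variables (K : fieldType) (B : falgType K).

Definition enveloping : falgType K := tensorK B B^c.
Definition env_mod : Type := B.
HB.instance Definition _ := GRing.Zmodule.on env_mod.

Definition env_act (x : enveloping) (b : env_mod) : env_mod :=
  liftK (fun (a : B) (c : B^c) => a * (b : B) * (c : B)) x.

Let act_bilinear (b : B) :
  bilinear_map (fun (a : B) (c : B^c) => a * b * (c : B)).
Proof.
split=> [k a a' c|k a c c'].
  by rewrite !mulrDl -!scalerAl.
by rewrite mulrDr -scalerAr.
Qed.

Fact env_actE (a : B) (c : B^c) (b : B) :
  env_act (tensK a c) b = a * b * (c : B).
Proof. exact: liftKE. Qed.

Let actPl b : linear (fun x => env_act x b : B).
Proof. exact: liftK_linear. Qed.

Let actPr x : linear (fun b : B => env_act x b : B).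
Proof.
move=> k b b'; move: x; apply: tensK_ext => [||a c].
- exact: actPl.
- by apply: (@linear_comb _ _ B); apply: actPl.
by rewrite !env_actE mulrDr mulrDl -scalerAr -scalerAl.
Qed.

Fact env_actA x y b : env_act x (env_act y b) = env_act (x * y) b.
Proof.
move: x; apply: (@tensK_ext _ _ _ B) => [||a c].
- exact: actPl.
- by move=> k x x'; rewrite mulrDl -scalerAl actPl.
move: y; apply: (@tensK_ext _ _ _ B) => [||a' c'].
- by move=> k y y'; rewrite actPl actPr.
- by move=> k y y'; rewrite mulrDr -scalerAr actPl.
by rewrite tensKM !env_actE !mulrA.
Qed.

Fact env_act1 : left_id 1 env_act.
Proof. by move=> b; rewrite -tensK1 env_actE mul1r mulr1. Qed.

Fact env_actDr : right_distributive env_act +%R.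
Proof. by move=> x b b'; have := actPr x 1 b b'; rewrite !scale1r. Qed.

Fact env_actDl b : {morph env_act^~ b : x y / x + y}.
Proof. by move=> x y; have := actPl b 1 x y; rewrite !scale1r. Qed.

HB.instance Definition _ := GRing.Zmodule_isLmodule.Build enveloping env_mod
  env_actA env_act1 env_actDr env_actDl.
End Enveloping.

Definition separable_alg (K : fieldType) (B : falgType K) : Prop :=
  projective (env_mod B : lmodType (enveloping B)).

(* A as an R-S-bimodule through algebra homomorphisms R -> A and S -> A. *)
Section RegularBimodule.
Variables (K : fieldType) (R S A : algType K).
Variables (f : {lrmorphism R -> A}) (g : {lrmorphism S -> A}).

Definition regbimod of {lrmorphism R -> A} & {lrmorphism S -> A} : Type := A.
Local Notation M := (regbimod f g).
HB.instance Definition _ := GRing.Lmodule.copy M A.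

Definition reg_lact (r : R) (m : M) : M := f r * (m : A).
Definition reg_ract (m : M) (s : S) : M := (m : A) * g s.

Fact reg_lactPl m : linear (reg_lact^~ m).
Proof. by move=> k r r'; rewrite /reg_lact linearP mulrDl -scalerAl. Qed.
Fact reg_lactPr r : linear (reg_lact r).
Proof. by move=> k m m'; rewrite /reg_lact mulrDr -scalerAr. Qed.
Fact reg_ractPl s : linear (reg_ract^~ s).
Proof. by move=> k m m'; rewrite /reg_ract mulrDl -scalerAl. Qed.
Fact reg_ractPr m : linear (reg_ract m).
Proof. by move=> k s s'; rewrite /reg_ract linearP mulrDr -scalerAr. Qed.
Fact reg_lact1 m : reg_lact 1 m = m.
Proof. by rewrite /reg_lact rmorph1 mul1r. Qed.
Fact reg_lactA r r' m : reg_lact (r * r') m = reg_lact r (reg_lact r' m).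
Proof. by rewrite /reg_lact rmorphM mulrA. Qed.
Fact reg_ract1 m : reg_ract m 1 = m.
Proof. by rewrite /reg_ract rmorph1 mulr1. Qed.
Fact reg_ractA m s s' : reg_ract m (s * s') = reg_ract (reg_ract m s) s'.
Proof. by rewrite /reg_ract rmorphM mulrA. Qed.
Fact reg_lract r m s :
  reg_ract (reg_lact r m) s = reg_lact r (reg_ract m s).
Proof. by rewrite /reg_ract /reg_lact mulrA. Qed.

HB.instance Definition _ := Lmodule_isBimodule.Build K R S M
  reg_lact1 reg_lactA reg_lactPl reg_lactPr
  reg_ract1 reg_ractA reg_ractPl reg_ractPr reg_lract.
End RegularBimodule.

Section DirectSum.
Variables (K : fieldType) (R S : algType K).

Section Pair.
Variables (M N : bimodType R S).
Local Notation T := (M * N)%type.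

Definition pair_lact (r : R) (x : T) : T := (lact r x.1, lact r x.2).
Definition pair_ract (x : T) (s : S) : T := (ract x.1 s, ract x.2 s).

Fact pair_lactPl x : linear (pair_lact^~ x).
Proof. by move=> k r r'; congr (_, _); rewrite lactPl. Qed.
Fact pair_lactPr r : linear (pair_lact r).
Proof. by move=> k x y; congr (_, _); rewrite lactPr. Qed.
Fact pair_ractPl s : linear (pair_ract^~ s).
Proof. by move=> k x y; congr (_, _); rewrite ractPl. Qed.
Fact pair_ractPr x : linear (pair_ract x).
Proof. by move=> k r r'; congr (_, _); rewrite ractPr. Qed.
Fact pair_lact1 x : pair_lact 1 x = x.
Proof. by case: x => m n; rewrite /pair_lact !lact1. Qed.
Fact pair_lactA r r' x : pair_lact (r * r') x = pair_lact r (pair_lact r' x).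
Proof. by rewrite /pair_lact !lactA. Qed.
Fact pair_ract1 x : pair_ract x 1 = x.
Proof. by case: x => m n; rewrite /pair_ract !ract1. Qed.
Fact pair_ractA x s s' : pair_ract x (s * s') = pair_ract (pair_ract x s) s'.
Proof. by rewrite /pair_ract !ractA. Qed.
Fact pair_lract r x s :
  pair_ract (pair_lact r x) s = pair_lact r (pair_ract x s).
Proof. by rewrite /pair_ract /pair_lact /= !lract. Qed.

HB.instance Definition _ := Lmodule_isBimodule.Build K R S T
  pair_lact1 pair_lactA pair_lactPl pair_lactPr
  pair_ract1 pair_ractA pair_ractPl pair_ractPr pair_lract.
End Pair.

Section Power.
Variables (I : finType) (M : bimodType R S).
Local Notation T := {ffun I -> M}.

Definition ffun_lact (r : R) (x : T) : T := [ffun i => lact r (x i)].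
Definition ffun_ract (x : T) (s : S) : T := [ffun i => ract (x i) s].

Fact ffun_lactPl x : linear (ffun_lact^~ x).
Proof. by move=> k r r'; apply/ffunP=> i; rewrite !ffunE lactPl. Qed.
Fact ffun_lactPr r : linear (ffun_lact r).
Proof. by move=> k x y; apply/ffunP=> i; rewrite !ffunE lactPr. Qed.
Fact ffun_ractPl s : linear (ffun_ract^~ s).
Proof. by move=> k x y; apply/ffunP=> i; rewrite !ffunE ractPl. Qed.
Fact ffun_ractPr x : linear (ffun_ract x).
Proof. by move=> k r r'; apply/ffunP=> i; rewrite !ffunE ractPr. Qed.
Fact ffun_lact1 x : ffun_lact 1 x = x.
Proof. by apply/ffunP=> i; rewrite !ffunE lact1. Qed.
Fact ffun_lactA r r' x : ffun_lact (r * r') x = ffun_lact r (ffun_lact r' x).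
Proof. by apply/ffunP=> i; rewrite !ffunE lactA. Qed.
Fact ffun_ract1 x : ffun_ract x 1 = x.
Proof. by apply/ffunP=> i; rewrite !ffunE ract1. Qed.
Fact ffun_ractA x s s' : ffun_ract x (s * s') = ffun_ract (ffun_ract x s) s'.
Proof. by apply/ffunP=> i; rewrite !ffunE ractA. Qed.
Fact ffun_lract r x s :
  ffun_ract (ffun_lact r x) s = ffun_lact r (ffun_ract x s).
Proof. by apply/ffunP=> i; rewrite !ffunE lract. Qed.

HB.instance Definition _ := Lmodule_isBimodule.Build K R S T
  ffun_lact1 ffun_lactA ffun_lactPl ffun_lactPr
  ffun_ract1 ffun_ractA ffun_ractPl ffun_ractPr ffun_lract.
End Power.

Definition bimod_iso (M N : bimodType R S) : Prop :=
  exists f : {linear M -> N},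
    [/\ bijective f, forall r m, f (lact r m) = lact r (f m)
      & forall m s, f (ract m s) = ract (f m) s].

Definition summand (M N : bimodType R S) : Prop :=
  exists Z : bimodType R S, bimod_iso (M * Z)%type N.
End DirectSum.

(* The R-T-bimodule M ⊗_S N; see over_lactE and over_ractE for the actions. *)
Section BimoduleTensor.
Variables (K : fieldType) (R S T : algType K).
Variables (M : bimodType R S) (N : bimodType S T).

Definition tensor_over : Type :=
  tensor (fun (m : M) (s : S) => ract m s) (fun s (n : N) => lact s n).
HB.instance Definition _ := GRing.Lmodule.on tensor_over.
Local Notation MN := tensor_over.

Definition tens_over (m : M) (n : N) : MN := tens _ _ m n.

Lemma tens_over_balanced m s n :
  tens_over (ract m s) n = tens_over m (lact s n).
Proof. exact: tens_balE. Qed.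

Definition over_lact (r : R) (x : MN) : MN :=
  tens_lift (fun m n => tens_over (lact r m) n) x.
Definition over_ract (x : MN) (t : T) : MN :=
  tens_lift (fun m n => tens_over m (ract n t)) x.

Let overPl n : linear (tens_over^~ n).
Proof. by move=> k m m'; rewrite /tens_over tensDl tensZl. Qed.
Let overPr m : linear (tens_over m).
Proof. by move=> k n n'; rewrite /tens_over tensDr tensZr. Qed.

Let lact_bal r : balanced (fun (m : M) (s : S) => ract m s)
  (fun s (n : N) => lact s n) (fun m n => tens_over (lact r m) n).
Proof.
split; first split.
- by move=> k m m' n; rewrite lactPr overPl.
- by move=> k m n n'; rewrite overPr.
- by move=> m s n; rewrite -lract tens_over_balanced.
Qed.
Let ract_bal t : balanced (fun (m : M) (s : S) => ract m s)
  (fun s (n : N) => lact s n) (fun m n => tens_over m (ract n t)).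
Proof.
split; first split.
- by move=> k m m' n; rewrite overPl.
- by move=> k m n n'; rewrite ractPl overPr.
- by move=> m s n; rewrite tens_over_balanced lract.
Qed.

Fact over_lactE r m n : over_lact r (tens_over m n) = tens_over (lact r m) n.
Proof. exact: tens_liftE. Qed.
Fact over_ractE m n t : over_ract (tens_over m n) t = tens_over m (ract n t).
Proof. exact: tens_liftE. Qed.

Fact over_lactPr r : linear (over_lact r).
Proof. exact: tens_lift_linear. Qed.
Fact over_ractPl t : linear (over_ract^~ t).
Proof. exact: tens_lift_linear. Qed.

Lemma tens_over_ext (W : lmodType K) (f g : MN -> W) : linear f -> linear g ->
  (forall m n, f (tens_over m n) = g (tens_over m n)) -> f =1 g.
Proof.
move=> lf lg fg; elim/tensor_ind=> [|m n x IH]; first by rewrite !linear_at0.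
have := fg m n; rewrite /tens_over => fgE.
by rewrite -[tens _ _ m n]scale1r lf lg IH fgE.
Qed.

Fact over_lactPl x : linear (over_lact^~ x).
Proof.
move=> k r r'; move: x; apply: tens_over_ext => [||m n].
- exact: over_lactPr.
- by apply: linear_comb; apply: over_lactPr.
by rewrite !over_lactE lactPl overPl.
Qed.
Fact over_ractPr x : linear (over_ract x).
Proof.
move=> k t t'; move: x; apply: tens_over_ext => [||m n].
- exact: over_ractPl.
- by apply: linear_comb; apply: over_ractPl.
by rewrite !over_ractE ractPr overPr.
Qed.
Fact over_lact1 x : over_lact 1 x = x.
Proof.
move: x; apply: tens_over_ext => [||m n] //; first exact: over_lactPr.
by rewrite over_lactE lact1.
Qed.
Fact over_lactA r r' x : over_lact (r * r') x = over_lact r (over_lact r' x).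
Proof.
move: x; apply: tens_over_ext => [||m n].
- exact: over_lactPr.
- by move=> k x x'; rewrite !over_lactPr.
by rewrite !over_lactE lactA.
Qed.
Fact over_ract1 x : over_ract x 1 = x.
Proof.
move: x; apply: tens_over_ext => [||m n] //; first exact: over_ractPl.
by rewrite over_ractE ract1.
Qed.
Fact over_ractA x t t' : over_ract x (t * t') = over_ract (over_ract x t) t'.
Proof.
move: x; apply: tens_over_ext => [||m n].
- exact: over_ractPl.
- by move=> k x x'; rewrite !over_ractPl.
by rewrite !over_ractE ractA.
Qed.
Fact over_lract r x t :
  over_ract (over_lact r x) t = over_lact r (over_ract x t).
Proof.
move: x; apply: tens_over_ext => [||m n].
- by move=> k x x'; rewrite over_lactPr over_ractPl.
- by move=> k x x'; rewrite over_ractPl over_lactPr.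
by rewrite over_lactE !over_ractE over_lactE.
Qed.

HB.instance Definition _ := Lmodule_isBimodule.Build K R T MN
  over_lact1 over_lactA over_lactPl over_lactPr
  over_ract1 over_ractA over_ractPl over_ractPr over_lract.
End BimoduleTensor.

Section DepthTwo.
Variables (K : fieldType) (A B : algType K) (iota : {lrmorphism B -> A}).
Local Notation idA := (idfun : {lrmorphism A -> A}).

Definition left_D2 : Prop := exists2 N : nat, (0 < N)%N &
  summand (tensor_over (regbimod iota iota) (regbimod iota idA))
          {ffun 'I_N -> regbimod iota idA}.

Definition right_D2 : Prop := exists2 N : nat, (0 < N)%N &
  summand (tensor_over (regbimod idA iota) (regbimod iota iota))
          {ffun 'I_N -> regbimod idA iota}.

Definition D2 : Prop := left_D2 /\ right_D2.
End DepthTwo.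

(* Main.v *)
From HB Require Import structures.
From mathcomp Require Import all_boot all_algebra falgebra.
Require Import Defs.

(** Both halves of depth two say that a bimodule X = A ⊗_B A divides the regular
    bimodule Y = A, i.e. that X is a direct summand of some Y^N.  This amounts
    to finitely many bimodule maps u_i : X -> Y and v_i : Y -> X with
    sum_i v_i u_i = id (summand_power_divides, divides_summand_power), and in
    this form complements never have to be mentioned again.  To treat the two
    halves at once, A is viewed as an R-S-bimodule through arbitrary
    homomorphisms f : R -> A and g : S -> A; left and right depth two are the
    cases (f, g) = (iota, id) and (f, g) = (id, iota).

    By induction on the number of factors it is enough to treat two of them,
    A = A1 ⊗ A2 over B = B1 ⊗ B2.

    From the factors to the product (divides_tensor): the interchange
    (a ⊗ c) ⊗ (a' ⊗ c') |-> (a ⊗ a') ⊗ (c ⊗ c') identifies X with X1 ⊗_K X2,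
    and the products u_i ⊗ u'_j and v_i ⊗ v'_j of the maps given for the two
    factors do the job for X.

    From the product to the first factor (divides_tensor1; the second one is
    symmetric): restrict the scalars from R1 ⊗ R2 and S1 ⊗ S2 to R1 and S1.  A
    basis of A2 shows that Y becomes a finite power of Y1.  On the other side
    X1 becomes a retract of X: it embeds by a ⊗ a' |-> (a ⊗ 1) ⊗ (a' ⊗ 1), and
    as A2 is not zero there is a linear form phi on A2 with phi 1 = 1, so that
    (a ⊗ c) ⊗ (a' ⊗ c') |-> phi (c c') a ⊗ a' is a left inverse.  It is well
    defined since c b c' does not depend on the side on which b acts.  Hence X1
    divides X, which divides Y, which divides Y1. *)

Set Implicit Arguments.
Unset Strict Implicit.
Unset Printing Implicit Defensive.

Import GRing.Theory.
Local Open Scope ring_scope.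

(** * Bare linear functions *)

(** The maps below are plain functions that come with a proof of linearity, as
    they are obtained from universal properties and often regarded as maps
    between several modules with the same carrier. *)
Section LinearFunctions.
Variables (K : fieldType) (U V : lmodType K) (f : U -> V).
Hypothesis lin_f : linear f.

Let fL : {linear U -> V} :=
  HB.pack f (GRing.isLinear.Build K U V *:%R f lin_f).

Lemma linear_funD x y : f (x + y) = f x + f y.
Proof. exact: (linearD fL). Qed.

Lemma linear_fun_sum (I : Type) (r : seq I) (P : pred I) (F : I -> U) :
  f (\sum_(i <- r | P i) F i) = \sum_(i <- r | P i) f (F i).
Proof. exact: (linear_sum fL). Qed.

Lemma linear_funZ k x : f (k *: x) = k *: f x.
Proof. exact: (linearZ_LR fL). Qed.
End LinearFunctions.

Lemma linear_comp (K : fieldType) (U V W : lmodType K)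
    (f : V -> W) (g : U -> V) :
  linear f -> linear g -> linear (fun x => f (g x)).
Proof. by move=> lf lg k x y; rewrite lg lf. Qed.

Lemma linear_fun_bigsum (K : fieldType) (U V : lmodType K) (I : finType)
    (f : I -> U -> V) :
  (forall i, linear (f i)) -> linear (fun x => \sum_i f i x).
Proof.
move=> lf k x y; rewrite scaler_sumr -big_split /=.
by apply: eq_bigr => i _; rewrite lf.
Qed.

(** * Divisibility of bimodules *)

Section Divisibility.
Variables (K : fieldType) (R S : algType K).

Definition bimod_hom (M N : bimodType R S) (f : M -> N) : Prop :=
  [/\ linear f, forall r m, f (lact r m) = lact r (f m)
    & forall m s, f (ract m s) = ract (f m) s].

Definition divides (M N : bimodType R S) : Prop :=
  exists (I : finType) (f : I -> M -> N) (g : I -> N -> M),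
    [/\ forall i, bimod_hom (f i), forall i, bimod_hom (g i)
      & forall x, \sum_i g i (f i x) = x].

Lemma lactr0 (M : bimodType R S) r : lact r (0 : M) = 0.
Proof. exact: linear_at0 (lactPr r). Qed.

Lemma ract0r (M : bimodType R S) s : ract (0 : M) s = 0.
Proof. exact: linear_at0 (ractPl s). Qed.

Lemma bimod_hom0 (M N : bimodType R S) : bimod_hom (fun _ : M => 0 : N).
Proof.
by split=> [k x y|r x|x s]; rewrite ?scaler0 ?addr0 ?lactr0 ?ract0r.
Qed.

Section Kernel.
Variables (M N : bimodType R S) (g : M -> N).

(** The proof that g is a bimodule map is an argument so that the predicate, and
    with it the type of its elements, can carry canonical structures. *)
Definition ker_pred of bimod_hom g : {pred M} := fun x => g x == 0.

Variable hom_g : bimod_hom g.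

Fact ker_pred_submod : submod_closed (ker_pred hom_g).
Proof.
have [lin_g _ _] := hom_g; split=> [|k x y /eqP gx /eqP gy].
  by rewrite unfold_in /ker_pred linear_at0.
by rewrite unfold_in /ker_pred lin_g gx gy scaler0 addr0.
Qed.

HB.instance Definition _ :=
  GRing.isSubmodClosed.Build K M (ker_pred hom_g) ker_pred_submod.

Record bimod_ker := BimodKer { ker_val : M; _ : ker_val \in ker_pred hom_g }.

HB.instance Definition _ := [isSub for ker_val].
HB.instance Definition _ := [Choice of bimod_ker by <:].
HB.instance Definition _ := [SubChoice_isSubLmodule of bimod_ker by <:].

Fact ker_lact_subproof r (x : bimod_ker) : lact r (val x) \in ker_pred hom_g.
Proof.
have [_ g_l _] := hom_g; have /eqP gx := valP x.
by rewrite unfold_in /ker_pred g_l gx lactr0.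
Qed.
Definition ker_lact r x := BimodKer (ker_lact_subproof r x).

Fact ker_ract_subproof (x : bimod_ker) s : ract (val x) s \in ker_pred hom_g.
Proof.
have [_ _ g_r] := hom_g; have /eqP gx := valP x.
by rewrite unfold_in /ker_pred g_r gx ract0r.
Qed.
Definition ker_ract x s := BimodKer (ker_ract_subproof x s).

Let valL (k : K) (x y : bimod_ker) : val (k *: x + y) = k *: val x + val y.
Proof. by rewrite linearP. Qed.

Fact ker_lact1 x : ker_lact 1 x = x.
Proof. by apply: val_inj; apply: lact1. Qed.
Fact ker_lactA r r' x : ker_lact (r * r') x = ker_lact r (ker_lact r' x).
Proof. by apply: val_inj; apply: lactA. Qed.
Fact ker_lactPl x : linear (ker_lact^~ x).
Proof. by move=> k r r'; apply: val_inj; rewrite valL; apply: lactPl. Qed.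
Fact ker_lactPr r : linear (ker_lact r).
Proof.
move=> k x y; apply: val_inj; rewrite valL -[RHS](lactPr r k (val x) (val y)).
by rewrite -valL.
Qed.
Fact ker_ract1 x : ker_ract x 1 = x.
Proof. by apply: val_inj; apply: ract1. Qed.
Fact ker_ractA x s s' : ker_ract x (s * s') = ker_ract (ker_ract x s) s'.
Proof. by apply: val_inj; apply: ractA. Qed.
Fact ker_ractPl s : linear (ker_ract^~ s).
Proof.
move=> k x y; apply: val_inj; rewrite valL -[RHS](ractPl s k (val x) (val y)).
by rewrite -valL.
Qed.
Fact ker_ractPr x : linear (ker_ract x).
Proof. by move=> k r r'; apply: val_inj; rewrite valL; apply: ractPr. Qed.
Fact ker_lract r x s : ker_ract (ker_lact r x) s = ker_lact r (ker_ract x s).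
Proof. by apply: val_inj; apply: lract. Qed.

HB.instance Definition _ := Lmodule_isBimodule.Build K R S bimod_ker
  ker_lact1 ker_lactA ker_lactPl ker_lactPr
  ker_ract1 ker_ractA ker_ractPl ker_ractPr ker_lract.
End Kernel.

(** The complement of a retract is the kernel of the retraction, through the
    decomposition y = f (g y) + (y - f (g y)). *)
Lemma retract_summand (M N : bimodType R S) (f : M -> N) (g : N -> M) :
  bimod_hom f -> bimod_hom g -> cancel f g -> summand M N.
Proof.
move=> hom_f hom_g fK; exists (bimod_ker hom_g).
have [lin_f f_l f_r] := hom_f; have [lin_g g_l g_r] := hom_g.
pose h (x : M * bimod_ker hom_g) : N := f x.1 + val x.2.
have lin_h : linear h.
  move=> k [x z] [y w]; rewrite /h lin_f.
  have -> : val (k *: z + w) = k *: val z + val w by rewrite linearP.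
  by rewrite scalerDr addrACA.
pose hL : {linear _ -> _} := HB.pack h (GRing.isLinear.Build K _ _ _ h lin_h).
have g_ker (z : bimod_ker hom_g) : g (val z) = 0 by apply/eqP/(valP z).
have proj_ker y : y - f (g y) \in ker_pred hom_g.
  rewrite unfold_in /ker_pred addrC -scaleN1r lin_g fK scaleN1r addNr //.
exists hL; split.
- exists (fun y => (g y, BimodKer (proj_ker y))) => [[x z]|y] /=.
    have gh : g (h (x, z)) = x.
      by rewrite /h /= (linear_funD lin_g) fK g_ker addr0.
    congr (_, _); first exact: gh.
    by apply: val_inj => /=; rewrite gh /h addrC addKr.
  by rewrite /h /= addrC subrK.
- move=> r [x z]; rewrite /= /h /= f_l.
  by rewrite (linear_funD (lactPr r)).
- move=> [x z] s; rewrite /= /h /= f_r.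
  by rewrite (linear_funD (ractPl s)).
Qed.

(** The maps are the coordinates of the inclusion of M in N^I and the
    restrictions of the projection to the copies of N. *)
Lemma summand_power_divides (I : finType) (M N : bimodType R S) :
  summand M {ffun I -> N} -> divides M N.
Proof.
move=> [Z [h [[h' hK h'K] h_l h_r]]].
have lin_h' : linear h'.
  by move=> k x y; rewrite -[x in LHS]h'K -[y in LHS]h'K -linearP hK.
have h'_l r y : h' (lact r y) = lact r (h' y) by rewrite -{1}[y]h'K -h_l hK.
have h'_r y s : h' (ract y s) = ract (h' y) s by rewrite -{1}[y]h'K -h_r hK.
pose inj i (y : N) : {ffun I -> N} := [ffun j => if j == i then y else 0].
exists I, (fun i x => h (x, 0) i), (fun i y => (h' (inj i y)).1).
split=> [i|i|x].
- split=> [k x y|r x|x s].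
  + have -> : (k *: x + y, 0) = k *: (x, 0) + (y, 0) :> M * Z.
      by congr (_, _); rewrite /= scaler0 addr0.
    by rewrite linearP !ffunE.
  + have -> : (lact r x, 0) = lact r ((x, 0) : M * Z).
      by congr (_, _); rewrite /= lactr0.
    by rewrite h_l ffunE.
  + have -> : (ract x s, 0) = ract ((x, 0) : M * Z) s.
      by congr (_, _); rewrite /= ract0r.
    by rewrite h_r ffunE.
- split=> [k x y|r x|x s].
  + have -> : inj i (k *: x + y) = k *: inj i x + inj i y.
      by apply/ffunP=> j; rewrite !ffunE; case: eqP; rewrite ?scaler0 ?addr0.
    by rewrite lin_h'.
  + have -> : inj i (lact r x) = lact r (inj i x).
      by apply/ffunP=> j; rewrite !ffunE; case: eqP; rewrite ?lactr0.
    by rewrite h'_l.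
  + have -> : inj i (ract x s) = ract (inj i x) s.
      by apply/ffunP=> j; rewrite !ffunE; case: eqP; rewrite ?ract0r.
    by rewrite h'_r.
have lin_fst : linear (fun y => (h' y).1) by move=> k y y'; rewrite lin_h'.
rewrite -(linear_fun_sum lin_fst) -[RHS]/((x, 0 : Z).1) -[in RHS](hK (x, 0)).
congr (h' _).1; apply/ffunP=> j; rewrite sum_ffunE (bigD1 j) //= ffunE eqxx.
by rewrite big1 ?addr0 // => i ij; rewrite ffunE eq_sym (negPf ij).
Qed.

(** The families assemble to M -> N^I -> M with composite the identity.  The
    extra index None, with zero maps, keeps the power positive when I is
    empty. *)
Lemma divides_summand_power (M N : bimodType R S) : divides M N ->
  exists2 n : nat, (0 < n)%N & summand M {ffun 'I_n -> N}.
Proof.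
move=> [I [f [g [hom_f hom_g fgK]]]].
exists #|{: option I}|; first by rewrite card_option.
pose f' (i : option I) : M -> N := if i is Some j then f j else fun=> 0.
pose g' (i : option I) : N -> M := if i is Some j then g j else fun=> 0.
have hom_f' i : bimod_hom (f' i).
  by case: i => [j|]; [exact: hom_f | exact: bimod_hom0].
have hom_g' i : bimod_hom (g' i).
  by case: i => [j|]; [exact: hom_g | exact: bimod_hom0].
apply: (@retract_summand _ _ (fun x => [ffun i => f' (enum_val i) x])
          (fun y => \sum_i g' (enum_val i) (y i))).
- split=> [k x y|r x|x s]; apply/ffunP=> i; rewrite !ffunE;
    by have [f_lin f_l f_r] := hom_f' (enum_val i); rewrite ?f_lin ?f_l ?f_r.
- split=> [k x y|r x|x s].
  + rewrite scaler_sumr -big_split /=; apply: eq_bigr => i _; rewrite !ffunE.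
    by have [-> _ _] := hom_g' (enum_val i).
  + rewrite (linear_fun_sum (lactPr r)); apply: eq_bigr => i _; rewrite ffunE.
    by have [_ -> _] := hom_g' (enum_val i).
  + rewrite (linear_fun_sum (ractPl s)); apply: eq_bigr => i _; rewrite ffunE.
    by have [_ _ ->] := hom_g' (enum_val i).
move=> x; under eq_bigr do rewrite ffunE.
rewrite -(big_enum_val (fun i => g' i (f' i x))) /=.
rewrite (bigD1 None) //= add0r -[RHS]fgK.
rewrite (reindex_omap (@Some I) id) => [|[]//] /=.
by apply: eq_bigl => i; rewrite eqxx.
Qed.
End Divisibility.

(** * The bimodule A ⊗_B A *)

Section RegularTensor.
Variables (K : fieldType) (R S A B : algType K) (iota : {lrmorphism B -> A}).
Variables (f : {lrmorphism R -> A}) (g : {lrmorphism S -> A}).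

Definition regtens : bimodType R S :=
  tensor_over (regbimod f iota) (regbimod iota g).

(** Arguments of type A, rather than of the two regular bimodules that have A
    as carrier, make products and images under iota type check directly. *)
Definition rtens (a a' : A) : regtens :=
  tens_over (a : regbimod f iota) (a' : regbimod iota g).

Definition reg_balanced (W : lmodType K) (h : A -> A -> W) : Prop :=
  bilinear_map h /\ forall a b a', h (a * iota b) a' = h a (iota b * a').

Lemma reg_balanced_rtens : reg_balanced rtens.
Proof.
split; last by move=> a b a'; apply: tens_over_balanced.
by split=> *; rewrite /rtens /tens_over ?tensDl ?tensDr ?tensZl ?tensZr.
Qed.

Definition reg_lift (W : lmodType K) (h : A -> A -> W) (x : regtens) : W :=
  tens_lift (h : regbimod f iota -> regbimod iota g -> W) x.

Lemma reg_liftE (W : lmodType K) (h : A -> A -> W) a a' :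
  reg_balanced h -> reg_lift h (rtens a a') = h a a'.
Proof. by move=> bal_h; apply: tens_liftE. Qed.

Lemma reg_lift_linear (W : lmodType K) (h : A -> A -> W) :
  reg_balanced h -> linear (reg_lift h).
Proof. by move=> bal_h; apply: tens_lift_linear. Qed.

Lemma rtens_ext (W : lmodType K) (h h' : regtens -> W) :
  linear h -> linear h' -> (forall a a', h (rtens a a') = h' (rtens a a')) ->
  h =1 h'.
Proof. exact: tens_over_ext. Qed.

Lemma lact_rtens r a a' : lact r (rtens a a') = rtens (f r * a) a'.
Proof. exact: over_lactE. Qed.

Lemma ract_rtens a a' s : ract (rtens a a') s = rtens a (a' * g s).
Proof. exact: over_ractE. Qed.
End RegularTensor.

Lemma D2_divides (K : fieldType) (A B : algType K) (iota : {lrmorphism B -> A}) :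
  D2 iota <->
  divides (regtens iota iota (idfun : {lrmorphism A -> A}))
          (regbimod iota (idfun : {lrmorphism A -> A})) /\
  divides (regtens iota (idfun : {lrmorphism A -> A}) iota)
          (regbimod (idfun : {lrmorphism A -> A}) iota).
Proof.
split=> [[[m _ dvd_l] [n _ dvd_r]]|[dvd_l dvd_r]].
  by split; [apply: summand_power_divides dvd_l
            | apply: summand_power_divides dvd_r].
by split; [apply: divides_summand_power | apply: divides_summand_power].
Qed.

(** * Maps on tensor products over K *)

Section TensorMaps.
Variable K : fieldType.

Lemma tensKPl (M N : lmodType K) (n : N) : linear (fun m : M => tensK m n).
Proof. by move=> k m m'; apply: (bilinear_tensK M N).1. Qed.

Lemma tensKPr (M N : lmodType K) (m : M) : linear (fun n : N => tensK m n).
Proof. by move=> k n n'; apply: (bilinear_tensK M N).2. Qed.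

(** Scaling is here that of the algebra A1 ⊗ A2, which is convertible but not
    syntactically equal to the scaling of the tensor product of vector spaces
    in tensKPl and tensKPr. *)
Lemma tensK_algPl (A1 A2 : falgType K) k (a b : A1) (c : A2) :
  tensK (k *: a + b) c = k *: (tensK a c : tensorK A1 A2) + tensK b c.
Proof. exact: tensKPl. Qed.

Lemma tensK_algPr (A1 A2 : falgType K) k (a : A1) (c d : A2) :
  tensK a (k *: c + d) = k *: (tensK a c : tensorK A1 A2) + tensK a d.
Proof. exact: tensKPr. Qed.

Section Map.
Variables (M M' N N' : lmodType K) (u : M -> M') (v : N -> N').
Hypotheses (lin_u : linear u) (lin_v : linear v).

Definition tensK_map : tensorK M N -> tensorK M' N' :=
  liftK (fun m n => tensK (u m) (v n)).

Let map_bilinear : bilinear_map (fun m n => tensK (u m) (v n)).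
Proof. by split=> *; rewrite ?lin_u ?lin_v ?tensKPl ?tensKPr. Qed.

Lemma tensK_mapE m n : tensK_map (tensK m n) = tensK (u m) (v n).
Proof. exact: liftKE. Qed.

Lemma tensK_map_linear : linear tensK_map.
Proof. exact: liftK_linear. Qed.
End Map.

Section Lift4.
Variables (M1 M2 N1 N2 W : lmodType K) (h : M1 -> M2 -> N1 -> N2 -> W).

Definition quadrilinear : Prop :=
  (forall a c, bilinear_map (h a c)) /\
  (forall a' c', bilinear_map (fun a c => h a c a' c')).

Definition liftK2 (x : tensorK M1 M2) (y : tensorK N1 N2) : W :=
  liftK (fun a c => liftK (h a c) y) x.

Hypothesis lin_h : quadrilinear.

Let lift_bilinear y : bilinear_map (fun a c => liftK (h a c) y).
Proof.
have [hr hl] := lin_h; split=> [k a a' c|k a c c'].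
  move: y; apply: tensK_ext => [||b d]; first exact: liftK_linear.
    by apply: linear_comb; apply: liftK_linear.
  by rewrite !liftKE // (hl b d).1.
move: y; apply: tensK_ext => [||b d]; first exact: liftK_linear.
  by apply: linear_comb; apply: liftK_linear.
by rewrite !liftKE // (hl b d).2.
Qed.

Lemma liftK2E a c a' c' : liftK2 (tensK a c) (tensK a' c') = h a c a' c'.
Proof. by rewrite /liftK2 liftKE // liftKE //; apply: lin_h.1. Qed.

Lemma liftK2_bilinear : bilinear_map liftK2.
Proof.
split=> [k x x' y|k x y y']; first exact: liftK_linear.
move: x; apply: tensK_ext => [||a c]; first exact: liftK_linear.
  by apply: linear_comb; apply: liftK_linear.
by rewrite /liftK2 !liftKE // liftK_linear //; apply: lin_h.1.
Qed.
End Lift4.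
End TensorMaps.

(** * Divisibility and restriction of scalars *)

Section Restriction.
Variables (K : fieldType) (R S R' S' : algType K).
Variables (jR : R' -> R) (jS : S' -> S).

(** Bimodule maps from M' to the restriction of M along jR and jS. *)
Definition hom_into (M' : bimodType R' S') (M : bimodType R S)
    (f : M' -> M) : Prop :=
  [/\ linear f, forall r m, f (lact r m) = lact (jR r) (f m)
    & forall m s, f (ract m s) = ract (f m) (jS s)].

(** Bimodule maps from the restriction of M along jR and jS to M'. *)
Definition hom_outof (M : bimodType R S) (M' : bimodType R' S')
    (f : M -> M') : Prop :=
  [/\ linear f, forall r m, f (lact (jR r) m) = lact r (f m)
    & forall m s, f (ract m (jS s)) = ract (f m) s].

(** After restriction of scalars M' divides M as a retract and N divides N'
    through the p_j and q_j, so M' divides N' by transitivity. *)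
Lemma divides_restrict (M N : bimodType R S) (M' N' : bimodType R' S')
    (i : M' -> M) (r : M -> M') (J : finType)
    (p : J -> N -> N') (q : J -> N' -> N) :
  hom_into i -> hom_outof r -> cancel i r ->
  (forall j, hom_outof (p j)) -> (forall j, hom_into (q j)) ->
  (forall y, \sum_j q j (p j y) = y) -> divides M N -> divides M' N'.
Proof.
move=> [lin_i il ir] [lin_r rl rr] iK hom_p hom_q qpK.
move=> [I [u [v [hom_u hom_v vuK]]]].
exists (I * J)%type, (fun t x => p t.2 (u t.1 (i x))),
  (fun t y => r (v t.1 (q t.2 y))).
split=> [[k j]|[k j]|x] /=.
- have [lin_u ul ur] := hom_u k; have [lin_p pl pr] := hom_p j.
  by split=> [a y z|a y|y a] /=; rewrite ?lin_i ?il ?ir ?lin_u ?ul ?ur;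
    rewrite ?lin_p ?pl ?pr.
- have [lin_v vl vr] := hom_v k; have [lin_q ql qr] := hom_q j.
  by split=> [a y z|a y|y a] /=; rewrite ?lin_q ?ql ?qr ?lin_v ?vl ?vr;
    rewrite ?lin_r ?rl ?rr.
rewrite -(pair_bigA _ (fun k j => r (v k (q j (p j (u k (i x))))))) /=.
rewrite -[RHS]iK -[in RHS](vuK (i x)) (linear_fun_sum lin_r).
apply: eq_bigr => k _; have [lin_v _ _] := hom_v k.
rewrite -[in RHS](qpK (u k (i x))) (linear_fun_sum lin_v).
by rewrite (linear_fun_sum lin_r).
Qed.
End Restriction.

Lemma exists_dual (K : fieldType) (V : vectType K) (v : V) : v != 0 ->
  exists2 phi : V -> K, scalar phi & phi v = 1.
Proof.
move=> v_neq0; set X := vbasis {: V}.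
have [i vi] : exists i, coord X i v != 0.
  apply/existsP; rewrite -negb_forall; apply: contra v_neq0 => /forallP v0.
  rewrite (coord_vbasis (memvf v)) big1 // => i _.
  by rewrite (eqP (v0 i)) scale0r.
exists (fun w => (coord X i v)^-1 * coord X i w); last exact: mulVf.
by move=> k x y; rewrite scalarP mulrDr mulrCA.
Qed.

(** * A product of two extensions *)

Section TwoFactors.
Variables (K : fieldType) (A1 A2 B1 B2 R1 R2 S1 S2 : falgType K).
Variables (iota1 : {lrmorphism B1 -> A1}) (iota2 : {lrmorphism B2 -> A2}).
Variables (f1 : {lrmorphism R1 -> A1}) (f2 : {lrmorphism R2 -> A2}).
Variables (g1 : {lrmorphism S1 -> A1}) (g2 : {lrmorphism S2 -> A2}).
Variable (iota : {lrmorphism tensorK B1 B2 -> tensorK A1 A2}).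
Variable (f : {lrmorphism tensorK R1 R2 -> tensorK A1 A2}).
Variable (g : {lrmorphism tensorK S1 S2 -> tensorK A1 A2}).
(** The maps iota, f and g are known by their values on pure tensors only, as
    each of them may be a tensor product of homomorphisms or the identity of
    A1 ⊗ A2. *)
Hypothesis iotaE : forall b c, iota (tensK b c) = tensK (iota1 b) (iota2 c).
Hypothesis fE : forall r s, f (tensK r s) = tensK (f1 r) (f2 s).
Hypothesis gE : forall r s, g (tensK r s) = tensK (g1 r) (g2 s).

Local Notation A := (tensorK A1 A2).
Local Notation X1 := (regtens iota1 f1 g1).
Local Notation X2 := (regtens iota2 f2 g2).
Local Notation X := (regtens iota f g).
Local Notation rt1 := (rtens iota1 f1 g1).
Local Notation rt2 := (rtens iota2 f2 g2).
Local Notation rt := (rtens iota f g).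
Local Notation Y1 := (regbimod f1 g1).
Local Notation Y2 := (regbimod f2 g2).
Local Notation Y := (regbimod f g).

Lemma rtens4_ext (W : lmodType K) (h h' : X -> W) : linear h -> linear h' ->
  (forall a c a' c', h (rt (tensK a c) (tensK a' c')) =
                     h' (rt (tensK a c) (tensK a' c'))) -> h =1 h'.
Proof.
move=> lin_h lin_h' hE; have [[rt_l rt_r] _] := reg_balanced_rtens iota f g.
apply: rtens_ext => // u v; move: u; apply: tensK_ext => [||a c].
- by move=> k u u'; rewrite rt_l lin_h.
- by move=> k u u'; rewrite rt_l lin_h'.
move: v; apply: tensK_ext => [||a' c'] //.
- by move=> k v v'; rewrite rt_r lin_h.
- by move=> k v v'; rewrite rt_r lin_h'.
Qed.

Section Lift4.
Variables (W : lmodType K) (h : A1 -> A2 -> A1 -> A2 -> W).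
Hypothesis lin_h : quadrilinear h.
Hypothesis bal_h : forall a c b1 b2 a' c',
  h (a * iota1 b1) (c * iota2 b2) a' c' =
  h a c (iota1 b1 * a') (iota2 b2 * c').

(** Balancedness over B1 ⊗ B2 may be tested on pure tensors, so one simultaneous
    condition on both factors is enough. *)
Lemma liftK2_balanced : reg_balanced iota (liftK2 h).
Proof.
have [lin_l lin_r] := liftK2_bilinear lin_h; split=> // u b v.
move: b; apply: tensK_ext => [||b1 b2].
- by move=> k b b'; rewrite linearP mulrDr -scalerAr lin_l.
- by move=> k b b'; rewrite linearP mulrDl -scalerAl lin_r.
move: u; apply: tensK_ext => [||a c].
- by move=> k u u'; rewrite mulrDl -scalerAl lin_l.
- by move=> k u u'; rewrite lin_l.
move: v; apply: tensK_ext => [||a' c'].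
- by move=> k v v'; rewrite lin_r.
- by move=> k v v'; rewrite mulrDr -scalerAr lin_r.
by rewrite iotaE !tensKM !liftK2E.
Qed.

Definition rtens_lift4 : X -> W := reg_lift (liftK2 h).

Lemma rtens_lift4_linear : linear rtens_lift4.
Proof. exact: reg_lift_linear liftK2_balanced. Qed.

Lemma rtens_lift4E a c a' c' :
  rtens_lift4 (rt (tensK a c) (tensK a' c')) = h a c a' c'.
Proof. by rewrite /rtens_lift4 reg_liftE ?liftK2E //; apply: liftK2_balanced. Qed.
End Lift4.

Lemma rt1_bilinear : bilinear_map rt1.
Proof. exact: (reg_balanced_rtens _ _ _).1. Qed.
Lemma rt2_bilinear : bilinear_map rt2.
Proof. exact: (reg_balanced_rtens _ _ _).1. Qed.

(** The interchange (a ⊗ c) ⊗ (a' ⊗ c') |-> (a ⊗ a') ⊗ (c ⊗ c'). *)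
Definition rtens_split : X -> tensorK X1 X2 :=
  rtens_lift4 (fun a c a' c' => tensK (rt1 a a') (rt2 c c')).

Let split_quadrilinear :
  quadrilinear (fun a c a' c' => tensK (rt1 a a') (rt2 c c')).
Proof.
have [l1 r1] := rt1_bilinear; have [l2 r2] := rt2_bilinear.
by split=> [a c|a' c']; split=> *; rewrite ?l1 ?r1 ?l2 ?r2 ?tensKPl ?tensKPr.
Qed.

Let split_balanced a c b1 b2 a' c' :
  tensK (rt1 (a * iota1 b1) a') (rt2 (c * iota2 b2) c') =
  tensK (rt1 a (iota1 b1 * a')) (rt2 c (iota2 b2 * c')).
Proof. by rewrite !(reg_balanced_rtens _ _ _).2. Qed.

Lemma rtens_split_linear : linear rtens_split.
Proof. exact: rtens_lift4_linear split_quadrilinear split_balanced. Qed.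

Lemma rtens_splitE a c a' c' :
  rtens_split (rt (tensK a c) (tensK a' c')) = tensK (rt1 a a') (rt2 c c').
Proof. exact: rtens_lift4E split_quadrilinear split_balanced _ _ _ _. Qed.

(** The inverse of the interchange is built one factor at a time: with a and a'
    fixed it is defined on X2, then a and a' are allowed to vary. *)
Definition rtens_merge_inner (a a' : A1) : X2 -> X :=
  reg_lift (fun c c' => rt (tensK a c) (tensK a' c')).

Definition rtens_merge : tensorK X1 X2 -> X :=
  liftK (fun (x1 : X1) (x2 : X2) =>
    reg_lift (fun a a' => rtens_merge_inner a a' x2) x1).

Let inner_balanced a a' :
  reg_balanced iota2 (fun c c' => rt (tensK a c) (tensK a' c')).
Proof.
have [[l r] bal] := reg_balanced_rtens iota f g.
split; first by split=> *; rewrite tensK_algPr (l, r).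
move=> c b c'; have := bal (tensK a c) (tensK 1 b) (tensK a' c').
by rewrite iotaE !tensKM rmorph1 mulr1 mul1r.
Qed.

Let outer_balanced x2 :
  reg_balanced iota1 (fun a a' => rtens_merge_inner a a' x2).
Proof.
have [[l r] bal] := reg_balanced_rtens iota f g.
have lin a a' : linear (rtens_merge_inner a a').
  exact: reg_lift_linear (inner_balanced a a').
split; [split=> [k a b a'|k a a' b]|move=> a b a']; move: x2;
  apply: rtens_ext => [||c c'] //; try exact: linear_comb.
- by rewrite /rtens_merge_inner !reg_liftE // tensK_algPl l.
- by rewrite /rtens_merge_inner !reg_liftE // tensK_algPl r.
rewrite /rtens_merge_inner !reg_liftE //.
have := bal (tensK a c) (tensK b 1) (tensK a' c').
by rewrite iotaE !tensKM rmorph1 mulr1 mul1r.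
Qed.

Let merge_bilinear : bilinear_map (fun (x1 : X1) (x2 : X2) =>
  reg_lift (fun a a' => rtens_merge_inner a a' x2) x1).
Proof.
split=> [k x x' y|k x y y']; first exact: reg_lift_linear.
move: x; apply: rtens_ext => [||a a']; first exact: reg_lift_linear.
  by apply: linear_comb; apply: reg_lift_linear.
by rewrite !reg_liftE // /rtens_merge_inner reg_lift_linear.
Qed.

Lemma rtens_merge_linear : linear rtens_merge.
Proof. exact: liftK_linear. Qed.

Lemma rtens_mergeE a c a' c' :
  rtens_merge (tensK (rt1 a a') (rt2 c c')) = rt (tensK a c) (tensK a' c').
Proof.
by rewrite /rtens_merge liftKE // reg_liftE // /rtens_merge_inner reg_liftE.
Qed.

Lemma rtens_splitK : cancel rtens_split rtens_merge.
Proof.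
apply: rtens4_ext => // [|a c a' c'].
  exact: linear_comp rtens_merge_linear rtens_split_linear.
by rewrite rtens_splitE rtens_mergeE.
Qed.

(** X1 ⊗ X2 is given no bimodule structure; equivariance is stated for pure
    tensors of scalars, which span R1 ⊗ R2. *)
Lemma rtens_merge_lact r1 r2 x1 x2 :
  rtens_merge (tensK (lact r1 x1) (lact r2 x2)) =
  lact (tensK r1 r2) (rtens_merge (tensK x1 x2)).
Proof.
move: x1; apply: rtens_ext => [||a a'].
- by move=> k x x'; rewrite lactPr tensKPl rtens_merge_linear.
- by move=> k x x'; rewrite tensKPl rtens_merge_linear lactPr.
move: x2; apply: rtens_ext => [||c c'].
- by move=> k x x'; rewrite lactPr tensKPr rtens_merge_linear.
- by move=> k x x'; rewrite tensKPr rtens_merge_linear lactPr.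
by rewrite !lact_rtens !rtens_mergeE lact_rtens fE tensKM.
Qed.

Lemma rtens_merge_ract x1 x2 s1 s2 :
  rtens_merge (tensK (ract x1 s1) (ract x2 s2)) =
  ract (rtens_merge (tensK x1 x2)) (tensK s1 s2).
Proof.
move: x1; apply: rtens_ext => [||a a'].
- by move=> k x x'; rewrite ractPl tensKPl rtens_merge_linear.
- by move=> k x x'; rewrite tensKPl rtens_merge_linear ractPl.
move: x2; apply: rtens_ext => [||c c'].
- by move=> k x x'; rewrite ractPl tensKPr rtens_merge_linear.
- by move=> k x x'; rewrite tensKPr rtens_merge_linear ractPl.
by rewrite !ract_rtens !rtens_mergeE ract_rtens gE tensKM.
Qed.

Section ProductMaps.
Variables (u1 : X1 -> Y1) (u2 : X2 -> Y2) (v1 : Y1 -> X1) (v2 : Y2 -> X2).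
Hypotheses (hom_u1 : bimod_hom u1) (hom_u2 : bimod_hom u2).
Hypotheses (hom_v1 : bimod_hom v1) (hom_v2 : bimod_hom v2).

Definition product_out (x : X) : Y :=
  tensK_map (u1 : X1 -> A1) (u2 : X2 -> A2) (rtens_split x).
Definition product_in (y : Y) : X :=
  rtens_merge (tensK_map (v1 : A1 -> X1) (v2 : A2 -> X2) (y : A)).

Let lin_u1 : linear (u1 : X1 -> A1). Proof. by case: hom_u1. Qed.
Let lin_u2 : linear (u2 : X2 -> A2). Proof. by case: hom_u2. Qed.
Let lin_v1 : linear (v1 : A1 -> X1). Proof. by case: hom_v1. Qed.
Let lin_v2 : linear (v2 : A2 -> X2). Proof. by case: hom_v2. Qed.

Lemma product_out_hom : bimod_hom product_out.
Proof.
have lin : linear product_out.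
  exact: linear_comp (tensK_map_linear lin_u1 lin_u2) rtens_split_linear.
have [_ u1l u1r] := hom_u1; have [_ u2l u2r] := hom_u2.
split=> // [r x|x s]; move: x; apply: rtens4_ext => [||a c a' c'].
- by move=> k x x'; rewrite lactPr lin.
- by move=> k x x'; rewrite lin lactPr.
- move: r; apply: (@tensK_ext _ R1 R2) => [||r1 r2].
  + by move=> k r r'; rewrite lactPl lin.
  + by move=> k r r'; rewrite lactPl.
  rewrite lact_rtens fE tensKM /product_out !rtens_splitE !tensK_mapE //.
  by rewrite -!lact_rtens u1l u2l -[RHS]/(_ * _) fE tensKM.
- by move=> k x x'; rewrite ractPl lin.
- by move=> k x x'; rewrite lin ractPl.
move: s; apply: (@tensK_ext _ S1 S2) => [||s1 s2].
+ by move=> k s s'; rewrite ractPr lin.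
+ by move=> k s s'; rewrite ractPr.
rewrite ract_rtens gE tensKM /product_out !rtens_splitE !tensK_mapE //.
by rewrite -!ract_rtens u1r u2r -[RHS]/(_ * _) gE tensKM.
Qed.

Lemma product_in_hom : bimod_hom product_in.
Proof.
have lin : linear product_in.
  exact: linear_comp rtens_merge_linear (tensK_map_linear lin_v1 lin_v2).
have [_ v1l v1r] := hom_v1; have [_ v2l v2r] := hom_v2.
split=> // [r x|x s]; move: x; apply: (@tensK_ext _ A1 A2) => [||a c].
- by move=> k x x'; rewrite lactPr lin.
- by move=> k x x'; rewrite lin lactPr.
- move: r; apply: (@tensK_ext _ R1 R2) => [||r1 r2].
  + by move=> k r r'; rewrite lactPl lin.
  + by move=> k r r'; rewrite lactPl.
  rewrite /product_in -[lact _ _]/(_ * _) fE tensKM !tensK_mapE //.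
  by rewrite -rtens_merge_lact -v1l -v2l.
- by move=> k x x'; rewrite ractPl lin.
- by move=> k x x'; rewrite lin ractPl.
move: s; apply: (@tensK_ext _ S1 S2) => [||s1 s2].
+ by move=> k s s'; rewrite ractPr lin.
+ by move=> k s s'; rewrite ractPr.
rewrite /product_in -[ract _ _]/(_ * _) gE tensKM !tensK_mapE //.
by rewrite -rtens_merge_ract -v1r -v2r.
Qed.
End ProductMaps.

(** Interchange, apply sum_ij (v_i u_i) ⊗ (v'_j u'_j) = id ⊗ id, and
    interchange back. *)
Lemma divides_tensor : divides X1 Y1 -> divides X2 Y2 -> divides X Y.
Proof.
move=> [I [u1 [v1 [hom_u1 hom_v1 vu1]]]] [J [u2 [v2 [hom_u2 hom_v2 vu2]]]].
exists (I * J)%type, (fun p => product_out (u1 p.1) (u2 p.2)),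
  (fun p => product_in (v1 p.1) (v2 p.2)).
have lin_out p : linear (product_out (u1 p.1) (u2 p.2)).
  by have [] := product_out_hom (hom_u1 p.1) (hom_u2 p.2).
have lin_in p : linear (product_in (v1 p.1) (v2 p.2)).
  by have [] := product_in_hom (hom_v1 p.1) (hom_v2 p.2).
split=> [p|p|]; [exact: product_out_hom | exact: product_in_hom |].
apply: rtens4_ext => // [|a c a' c'].
  by apply: linear_fun_bigsum => p; apply: (linear_comp (lin_in p) (lin_out p)).
rewrite -[RHS]rtens_splitK rtens_splitE.
rewrite -[in RHS](vu1 (rt1 a a')) -[in RHS](vu2 (rt2 c c')).
rewrite (linear_fun_sum (@tensKPl _ X1 X2 _)) /=.
under [in RHS]eq_bigr do rewrite (linear_fun_sum (@tensKPr _ X1 X2 _)).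
rewrite pair_bigA /= (linear_fun_sum rtens_merge_linear).
apply: eq_bigr => p _; rewrite /product_in /product_out rtens_splitE.
have [lin_u1 _ _] := hom_u1 p.1; have [lin_u2 _ _] := hom_u2 p.2.
have [lin_v1 _ _] := hom_v1 p.1; have [lin_v2 _ _] := hom_v2 p.2.
by rewrite !tensK_mapE.
Qed.
(** * Back to the factors *)

Section Factors.
Local Notation basis1 := (vbasis {: A1}).
Local Notation basis2 := (vbasis {: A2}).

(** The coordinates of an element of A1 ⊗ A2, viewed as a free A1-module on the
    basis of A2, are in A1; coef2 exchanges the roles of the factors. *)
Definition coef1 j : A -> A1 := liftK (fun a c => coord basis2 j c *: a).
Definition coef2 j : A -> A2 := liftK (fun a c => coord basis1 j a *: c).

Let coef1_bilinear j : bilinear_map (fun (a : A1) c => coord basis2 j c *: a).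
Proof.
split=> [k a a' c|k a c c']; first by rewrite scalerDr !scalerA mulrC.
by rewrite scalarP scalerDl scalerA.
Qed.

Let coef2_bilinear j : bilinear_map (fun a (c : A2) => coord basis1 j a *: c).
Proof.
split=> [k a a' c|k a c c']; last by rewrite scalerDr !scalerA mulrC.
by rewrite scalarP scalerDl scalerA.
Qed.

Lemma coef1K (y : A) : \sum_(j < _) tensK (coef1 j y) (basis2`_j) = y.
Proof.
move: y; apply: (@tensK_ext _ A1 A2) => [||a c] //.
  apply: linear_fun_bigsum => j k x x'.
  by rewrite /coef1 (liftK_linear (coef1_bilinear j)) tensKPl.
rewrite [in RHS](coord_vbasis (memvf c)) (linear_fun_sum (tensKPr _)).
apply: eq_bigr => j _; rewrite /coef1 liftKE //.
by rewrite (linear_funZ (tensKPl _)) (linear_funZ (tensKPr _)).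
Qed.

Lemma coef2K (y : A) : \sum_(j < _) tensK (basis1`_j) (coef2 j y) = y.
Proof.
move: y; apply: (@tensK_ext _ A1 A2) => [||a c] //.
  apply: linear_fun_bigsum => j k x x'.
  by rewrite /coef2 (liftK_linear (coef2_bilinear j)) tensKPr.
rewrite [in RHS](coord_vbasis (memvf a)) (linear_fun_sum (tensKPl _)).
apply: eq_bigr => j _; rewrite /coef2 liftKE //.
by rewrite (linear_funZ (tensKPl _)) (linear_funZ (tensKPr _)).
Qed.

Lemma coef1_outof j :
  hom_outof (fun r => tensK r 1) (fun s => tensK s 1) (coef1 j : Y -> Y1).
Proof.
have lin : linear (coef1 j) by apply: liftK_linear.
split=> // [r y|y s]; move: y; apply: (@tensK_ext _ A1 A2) => [||a c].
- by move=> k y y'; rewrite lactPr lin.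
- by move=> k y y'; rewrite lin lactPr.
- rewrite -[lact _ _]/(_ * _) -[RHS]/(_ * _) fE rmorph1 tensKM mul1r.
  by rewrite /coef1 !liftKE // -scalerAr.
- by move=> k y y'; rewrite ractPl lin.
- by move=> k y y'; rewrite lin ractPl.
rewrite -[ract _ _]/(_ * _) -[RHS]/(_ * _) gE rmorph1 tensKM mulr1.
by rewrite /coef1 !liftKE // -scalerAl.
Qed.

Lemma coef2_outof j :
  hom_outof (fun r => tensK 1 r) (fun s => tensK 1 s) (coef2 j : Y -> Y2).
Proof.
have lin : linear (coef2 j) by apply: liftK_linear.
split=> // [r y|y s]; move: y; apply: (@tensK_ext _ A1 A2) => [||a c].
- by move=> k y y'; rewrite lactPr lin.
- by move=> k y y'; rewrite lin lactPr.
- rewrite -[lact _ _]/(_ * _) -[RHS]/(_ * _) fE rmorph1 tensKM mul1r.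
  by rewrite /coef2 !liftKE // -scalerAr.
- by move=> k y y'; rewrite ractPl lin.
- by move=> k y y'; rewrite lin ractPl.
rewrite -[ract _ _]/(_ * _) -[RHS]/(_ * _) gE rmorph1 tensKM mulr1.
by rewrite /coef2 !liftKE // -scalerAl.
Qed.

Lemma tensK_into1 c :
  hom_into (fun r => tensK r 1) (fun s => tensK s 1)
    (fun a : Y1 => tensK (a : A1) c : Y).
Proof.
split=> [|r a|a s]; first exact: tensKPl.
  by rewrite -[RHS]/(_ * _) fE rmorph1 tensKM mul1r.
by rewrite -[RHS]/(_ * _) gE rmorph1 tensKM mulr1.
Qed.

Lemma tensK_into2 a :
  hom_into (fun r => tensK 1 r) (fun s => tensK 1 s)
    (fun c : Y2 => tensK a (c : A2) : Y).
Proof.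
split=> [|r c|c s]; first exact: tensKPr.
  by rewrite -[RHS]/(_ * _) fE rmorph1 tensKM mul1r.
by rewrite -[RHS]/(_ * _) gE rmorph1 tensKM mulr1.
Qed.

Definition rtens_in1 : X1 -> X :=
  reg_lift (fun a a' => rt (tensK a 1) (tensK a' 1)).
Definition rtens_in2 : X2 -> X :=
  reg_lift (fun c c' => rt (tensK 1 c) (tensK 1 c')).

Let in1_balanced : reg_balanced iota1 (fun a a' => rt (tensK a 1) (tensK a' 1)).
Proof.
have [[l r] bal] := reg_balanced_rtens iota f g.
split; first by split=> *; rewrite tensK_algPl (l, r).
move=> a b a'; have := bal (tensK a 1) (tensK b 1) (tensK a' 1).
by rewrite iotaE !tensKM rmorph1 mulr1.
Qed.

Let in2_balanced : reg_balanced iota2 (fun c c' => rt (tensK 1 c) (tensK 1 c')).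
Proof.
have [[l r] bal] := reg_balanced_rtens iota f g.
split; first by split=> *; rewrite tensK_algPr (l, r).
move=> c b c'; have := bal (tensK 1 c) (tensK 1 b) (tensK 1 c').
by rewrite iotaE !tensKM rmorph1 mulr1.
Qed.

Lemma rtens_in1_into :
  hom_into (fun r => tensK r 1) (fun s => tensK s 1) rtens_in1.
Proof.
have lin : linear rtens_in1 by apply: reg_lift_linear.
split=> // [r x|x s]; move: x; apply: rtens_ext => [||a a'].
- by move=> k x x'; rewrite lactPr lin.
- by move=> k x x'; rewrite lin lactPr.
- rewrite lact_rtens /rtens_in1 !reg_liftE // lact_rtens fE rmorph1.
  by rewrite tensKM mul1r.
- by move=> k x x'; rewrite ractPl lin.
- by move=> k x x'; rewrite lin ractPl.
rewrite ract_rtens /rtens_in1 !reg_liftE // ract_rtens gE rmorph1.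
by rewrite tensKM mulr1.
Qed.

Lemma rtens_in2_into :
  hom_into (fun r => tensK 1 r) (fun s => tensK 1 s) rtens_in2.
Proof.
have lin : linear rtens_in2 by apply: reg_lift_linear.
split=> // [r x|x s]; move: x; apply: rtens_ext => [||a a'].
- by move=> k x x'; rewrite lactPr lin.
- by move=> k x x'; rewrite lin lactPr.
- rewrite lact_rtens /rtens_in2 !reg_liftE // lact_rtens fE rmorph1.
  by rewrite tensKM mul1r.
- by move=> k x x'; rewrite ractPl lin.
- by move=> k x x'; rewrite lin ractPl.
rewrite ract_rtens /rtens_in2 !reg_liftE // ract_rtens gE rmorph1.
by rewrite tensKM mulr1.
Qed.

Section Contract1.
Variables (phi : A2 -> K) (phi_scalar : scalar phi) (phi1 : phi 1 = 1).

(** The retraction of X on X1; the product c * c' absorbs the elements of B2 that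
    pass from one side of the tensor product to the other. *)
Definition contract1 : X -> X1 :=
  rtens_lift4 (fun a c a' c' => phi (c * c') *: rt1 a a').

Let quad : quadrilinear (fun a c a' c' => phi (c * c') *: rt1 a a').
Proof.
have [l r] := rt1_bilinear.
split=> [a c|a' c']; split=> *;
  rewrite ?l ?r ?mulrDl ?mulrDr -?scalerAl -?scalerAr;
  rewrite ?phi_scalar ?scalerDl ?scalerDr ?scalerA //;
  by rewrite (mulrC (phi _)).
Qed.

Let bal a c b1 b2 a' c' :
  phi (c * iota2 b2 * c') *: rt1 (a * iota1 b1) a' =
  phi (c * (iota2 b2 * c')) *: rt1 a (iota1 b1 * a').
Proof. by rewrite mulrA (reg_balanced_rtens _ _ _).2. Qed.

Let lin : linear contract1. Proof. exact: rtens_lift4_linear quad bal. Qed.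
Let contractE a c a' c' :
  contract1 (rt (tensK a c) (tensK a' c')) = phi (c * c') *: rt1 a a'.
Proof. exact: rtens_lift4E quad bal _ _ _ _. Qed.

Lemma contract1_outof :
  hom_outof (fun r => tensK r 1) (fun s => tensK s 1) contract1.
Proof.
split=> // [r x|x s]; move: x; apply: rtens4_ext => [||a c a' c'].
- by move=> k x x'; rewrite lactPr lin.
- by move=> k x x'; rewrite lin lactPr.
- rewrite lact_rtens fE rmorph1 tensKM mul1r !contractE.
  by rewrite (linear_funZ (lactPr r)) lact_rtens.
- by move=> k x x'; rewrite ractPl lin.
- by move=> k x x'; rewrite lin ractPl.
rewrite ract_rtens gE rmorph1 tensKM mulr1 !contractE.
by rewrite (linear_funZ (ractPl s)) ract_rtens.
Qed.

Lemma contract1K : cancel rtens_in1 contract1.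
Proof.
apply: rtens_ext => // [|a a'].
  by apply: linear_comp lin _; apply: reg_lift_linear.
by rewrite /rtens_in1 reg_liftE // contractE mulr1 phi1 scale1r.
Qed.
End Contract1.

Section Contract2.
Variables (phi : A1 -> K) (phi_scalar : scalar phi) (phi1 : phi 1 = 1).

Definition contract2 : X -> X2 :=
  rtens_lift4 (fun a c a' c' => phi (a * a') *: rt2 c c').

Let quad : quadrilinear (fun a c a' c' => phi (a * a') *: rt2 c c').
Proof.
have [l r] := rt2_bilinear.
split=> [a c|a' c']; split=> *;
  rewrite ?l ?r ?mulrDl ?mulrDr -?scalerAl -?scalerAr;
  rewrite ?phi_scalar ?scalerDl ?scalerDr ?scalerA //;
  by rewrite (mulrC (phi _)).
Qed.

Let bal a c b1 b2 a' c' :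
  phi (a * iota1 b1 * a') *: rt2 (c * iota2 b2) c' =
  phi (a * (iota1 b1 * a')) *: rt2 c (iota2 b2 * c').
Proof. by rewrite mulrA (reg_balanced_rtens _ _ _).2. Qed.

Let lin : linear contract2. Proof. exact: rtens_lift4_linear quad bal. Qed.
Let contractE a c a' c' :
  contract2 (rt (tensK a c) (tensK a' c')) = phi (a * a') *: rt2 c c'.
Proof. exact: rtens_lift4E quad bal _ _ _ _. Qed.

Lemma contract2_outof :
  hom_outof (fun r => tensK 1 r) (fun s => tensK 1 s) contract2.
Proof.
split=> // [r x|x s]; move: x; apply: rtens4_ext => [||a c a' c'].
- by move=> k x x'; rewrite lactPr lin.
- by move=> k x x'; rewrite lin lactPr.
- rewrite lact_rtens fE rmorph1 tensKM mul1r !contractE.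
  by rewrite (linear_funZ (lactPr r)) lact_rtens.
- by move=> k x x'; rewrite ractPl lin.
- by move=> k x x'; rewrite lin ractPl.
rewrite ract_rtens gE rmorph1 tensKM mulr1 !contractE.
by rewrite (linear_funZ (ractPl s)) ract_rtens.
Qed.

Lemma contract2K : cancel rtens_in2 contract2.
Proof.
apply: rtens_ext => // [|a a'].
  by apply: linear_comp lin _; apply: reg_lift_linear.
by rewrite /rtens_in2 reg_liftE // contractE mulr1 phi1 scale1r.
Qed.
End Contract2.

Lemma divides_tensor1 : divides X Y -> divides X1 Y1.
Proof.
have [phi phi_scalar phi1] := exists_dual (oner_neq0 A2).
apply: divides_restrict rtens_in1_into (contract1_outof phi_scalar)
  (contract1K phi_scalar phi1) coef1_outof (fun j => tensK_into1 _) coef1K.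
Qed.

Lemma divides_tensor2 : divides X Y -> divides X2 Y2.
Proof.
have [phi phi_scalar phi1] := exists_dual (oner_neq0 A1).
apply: divides_restrict rtens_in2_into (contract2_outof phi_scalar)
  (contract2K phi_scalar phi1) coef2_outof (fun j => tensK_into2 _) coef2K.
Qed.
End Factors.
End TwoFactors.

(** * Depth two of tensor products *)

Lemma D2_tens_hom (K : fieldType) (A1 A2 B1 B2 : falgType K)
    (iota1 : {lrmorphism B1 -> A1}) (iota2 : {lrmorphism B2 -> A2}) :
  D2 (tens_hom iota1 iota2) <-> D2 iota1 /\ D2 iota2.
Proof.
have iotaE := tens_homE iota1 iota2.
pose id1 : {lrmorphism A1 -> A1} := idfun.
pose id2 : {lrmorphism A2 -> A2} := idfun.
pose id12 : {lrmorphism tensorK A1 A2 -> tensorK A1 A2} := idfun.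
have idE a c : id12 (tensK a c) = tensK (id1 a) (id2 c) by [].
split=> [/D2_divides[dvd_l dvd_r]|].
  split; apply/D2_divides; split.
  - exact: (divides_tensor1 (f2 := iota2) (g2 := id2) iotaE iotaE idE dvd_l).
  - exact: (divides_tensor1 (f2 := id2) (g2 := iota2) iotaE idE iotaE dvd_r).
  - exact: (divides_tensor2 (f1 := iota1) (g1 := id1) iotaE iotaE idE dvd_l).
  - exact: (divides_tensor2 (f1 := id1) (g1 := iota1) iotaE idE iotaE dvd_r).
move=> [/D2_divides[dvd_l1 dvd_r1] /D2_divides[dvd_l2 dvd_r2]].
apply/D2_divides; split.
  exact: (divides_tensor iotaE iotaE idE dvd_l1 dvd_l2).
exact: (divides_tensor iotaE idE iotaE dvd_r1 dvd_r2).
Qed.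

Theorem proposition3p5 (K : fieldType) (n : nat)
    (A B : 'I_n.+1 -> falgType K)
    (iota : forall k, {lrmorphism B k -> A k})
    (separable_B : forall k, separable_alg (B k)) :
  D2 (tens_fam_hom iota) <-> (forall k, D2 (iota k)).
Proof.
clear separable_B; elim: n A B iota => [|n IHn] A B iota.
  by split=> [D2_iota k|]; [rewrite (ord1 k) | apply].
have IH := IHn _ _ (fun i => iota (lift ord0 i)).
split=> [/D2_tens_hom[D2_0 /IH D2_S] k|D2_iota].
  by case: (unliftP ord0 k) => [j|] ->.
by apply/D2_tens_hom; split; [apply: D2_iota | apply/IH => j; apply: D2_iota].
Qed.
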